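(* Suppose that $\Sigma_s^k\subset\mathbb R^\ell$, $0\le s\le1$, is a smooth one-parameter family of closed compact $k$-dimensional submanifolds bounded locally graphically in $C^{2,\alpha}$ (uniformly in $s$). Then $\lambda(\Sigma_s)$ is continuous in $s$.
   Context: For a $k$-dimensional submanifold $\Sigma\subset\mathbb R^\ell$, the entropy is $$\lambda(\Sigma)=\sup_{x_0\in\mathbb R^\ell,\ t_0>0}F_{x_0,t_0}(\Sigma),\qquad F_{x_0,t_0}(\Sigma)=\frac{1}{(4\pi t_0)^{k/2}}\int_\Sigma e^{-\frac{|x-x_0|^2}{4t_0}}\,d\mu.$$ ''Bounded locally graphically in $C^{2,\alpha}$'' means that there is a constant $C$ such that near each of its points every $\Sigma_s$ is, in a ball of radius depending only on $C$ (say $1/C$), a graph over its tangent plane at that point of a function with $C^{2,\alpha}$ norm at most $C$; here $0<\alpha<1$. Closed means compact without boundary. *)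

(* Defs.v *)
From HB Require Import structures.
From mathcomp Require Import all_boot all_order all_algebra.
From mathcomp Require Import all_classical all_reals all_analysis.

Set Implicit Arguments.
Unset Strict Implicit.
Unset Printing Implicit Defensive.

Import Order.TTheory GRing.Theory Num.Theory.
Import numFieldNormedType.Exports.

Local Open Scope classical_set_scope.
Local Open Scope ring_scope.

(* The library norm on ['rV[R]_n] is the sup norm (same topology). *)
Definition enorm (R : realType) (n : nat) (v : 'rV[R]_n) : R :=
  Num.sqrt (\sum_(j < n) v 0 j ^+ 2).

Definition eball (R : realType) (n : nat) (p : 'rV[R]_n) (r : R)
  : set 'rV[R]_n := [set x | enorm (x - p) < r].

(** Differentiability classes *)

Definition partial (R : realType) (n m : nat) (i : 'I_n)
  (f : 'rV[R]_n -> 'rV[R]_m) : 'rV[R]_n -> 'rV[R]_m :=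
  fun x => 'D_(delta_mx 0 i) f x.

Definition partials (R : realType) (n m : nat) (s : seq 'I_n)
  (f : 'rV[R]_n -> 'rV[R]_m) : 'rV[R]_n -> 'rV[R]_m :=
  foldr (@partial R n m) f s.

(* [U] is meant to be open. *)
Definition of_class (R : realType) (n m r : nat) (U : set 'rV[R]_n)
  (f : 'rV[R]_n -> 'rV[R]_m) : Prop :=
  forall (s : seq 'I_n) (x : 'rV[R]_n), (size s <= r)%N -> U x ->
    {for x, continuous (partials s f)} /\
    ((size s < r)%N ->
       forall i : 'I_n, derivable (partials s f) x (delta_mx 0 i)).

(* Smoothness on an arbitrary subset [A] of R^n: [f] extends smoothly to a
   neighbourhood of each point of [A].  Values of [f] off [A] are irrelevant. *)
Definition smooth_on (R : realType) (n m : nat) (A : set 'rV[R]_n)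
  (f : 'rV[R]_n -> 'rV[R]_m) : Prop :=
  forall x, A x ->
    exists (U : set 'rV[R]_n) (g : 'rV[R]_n -> 'rV[R]_m),
      [/\ open U, U x, forall r, of_class r U g &
          forall y, A y -> U y -> f y = g y].

Definition diffeo (R : realType) (n m : nat) (A : set 'rV[R]_n)
  (B : set 'rV[R]_m) (f : 'rV[R]_n -> 'rV[R]_m) : Prop :=
  [/\ f @` A = B, smooth_on A f &
      exists2 g : 'rV[R]_m -> 'rV[R]_n,
        smooth_on B g & forall x, A x -> g (f x) = x].

(** Embedded submanifolds of R^l *)

Definition local_param (R : realType) (k l : nat) (S : set 'rV[R]_l)
  (U : set 'rV[R]_k) (phi : 'rV[R]_k -> 'rV[R]_l) : Prop :=
  open U /\ exists2 W : set 'rV[R]_l, open W & diffeo U (S `&` W) phi.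

Definition submanifold (R : realType) (k l : nat) (S : set 'rV[R]_l) : Prop :=
  forall p, S p -> exists (U : set 'rV[R]_k) (phi : 'rV[R]_k -> 'rV[R]_l),
    local_param S U phi /\ (phi @` U) p.

Definition closed_submanifold (R : realType) (k l : nat) (S : set 'rV[R]_l)
  : Prop := submanifold k S /\ compact S.

(* [jacobian phi x] is the k x l matrix acting on row vectors from the right. *)
Definition tangent_space (R : realType) (k l : nat) (S : set 'rV[R]_l)
  (p : 'rV[R]_l) : set 'rV[R]_l :=
  [set w | exists (U : set 'rV[R]_k) (phi : 'rV[R]_k -> 'rV[R]_l) x v,
     [/\ local_param S U phi, U x, phi x = p & w = v *m jacobian phi x]].

(* [F] is defined on M x [0, 1], viewed inside R^(N + 1), where M is a closed
   k-manifold; each slice F(., s) is a diffeomorphism from M onto [S s].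
   Taking M inside some R^N is no restriction (M could even be [S 0]). *)
Definition smooth_family (R : realType) (k l : nat) (S : R -> set 'rV[R]_l)
  : Prop :=
  (forall s : R, 0 <= s <= 1 -> closed_submanifold k (S s)) /\
  exists (N : nat) (M : set 'rV[R]_N) (F : 'rV[R]_(N + 1) -> 'rV[R]_l),
    [/\ closed_submanifold k M,
        smooth_on [set z | exists (x : 'rV[R]_N) (s : R), [/\ M x, 0 <= s <= 1 &
                                          z = row_mx x (s%:M : 'rV[R]_1)]] F &
        forall s : R, 0 <= s <= 1 ->
          diffeo M (S s) (fun x => F (row_mx x (s%:M : 'rV[R]_1)))].

(** Local graphical bounds in C^{2,alpha} *)

Definition sup_norm (R : realType) (n m : nat) (O : set 'rV[R]_n)
  (g : 'rV[R]_n -> 'rV[R]_m) : \bar R :=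
  ereal_sup [set (enorm (g x))%:E | x in O].

(* The pairs x = y contribute 0 / 0 = 0. *)
Definition holder_seminorm (R : realType) (n m : nat) (alpha : R)
  (O : set 'rV[R]_n) (g : 'rV[R]_n -> 'rV[R]_m) : \bar R :=
  ereal_sup [set (enorm (g x.1 - g x.2) / enorm (x.1 - x.2) `^ alpha)%:E
            | x in O `*` O].

Definition C2alpha_norm (R : realType) (n m : nat) (alpha : R)
  (O : set 'rV[R]_n) (u : 'rV[R]_n -> 'rV[R]_m) : \bar R :=
  (sup_norm O u + \sum_(i < n) sup_norm O (partial i u)
   + \sum_(i < n) \sum_(j < n) sup_norm O (partials [:: i; j] u)
   + \sum_(i < n) \sum_(j < n)
       holder_seminorm alpha O (partials [:: i; j] u))%E.

(* The rows of [E] are an orthonormal basis of the tangent space at [p], and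
   identify R^k with it; [u] takes values in the normal space at [p]. *)
Definition graph_near (R : realType) (k l : nat) (alpha C : R)
  (S : set 'rV[R]_l) (p : 'rV[R]_l) : Prop :=
  exists (E : 'M[R]_(k, l)) (u : 'rV[R]_k -> 'rV[R]_l),
    let O := eball 0 C^-1 in
    [/\ E *m E^T = 1%:M /\ tangent_space k S p = range (fun v => v *m E),
        forall v, O v -> u v *m E^T = 0,
        of_class 2 O u,
        (C2alpha_norm alpha O u <= C%:E)%E &
        S `&` eball p C^-1 =
          [set p + v *m E + u v | v in O] `&` eball p C^-1].

Definition locally_graphically_bounded (R : realType) (k l : nat) (alpha : R)
  (S : R -> set 'rV[R]_l) : Prop :=
  exists2 C : R, 0 < C &
    forall (s : R) p, 0 <= s <= 1 -> S s p -> graph_near k alpha C (S s) p.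

(** The induced k-dimensional measure and the entropy *)

(* Integral over R^n of a nonnegative Borel function, as an iterated Lebesgue
   integral (Tonelli). *)
Fixpoint integral_rV (R : realType) (n : nat)
  : ('rV[R]_n -> \bar R) -> \bar R :=
  match n with
  | 0 => fun f => f 0
  | n'.+1 => fun f => (\int[lebesgue_measure]_x
      integral_rV (fun y : 'rV[R]_n' => f (row_mx (x%:M : 'rV[R]_1) y)))%E
  end.

Definition borel_rV (R : realType) (l : nat) :=
  g_sigma_algebraType (@open 'rV[R]_l).

(* sqrt(det g), g the first fundamental form *)
Definition area_density (R : realType) (k l : nat)
  (phi : 'rV[R]_k -> 'rV[R]_l) (x : 'rV[R]_k) : R :=
  Num.sqrt (\det (jacobian phi x *m (jacobian phi x)^T)).

Definition is_area_measure (R : realType) (k l : nat) (S : set 'rV[R]_l)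
  (mu : {measure set (borel_rV R l) -> \bar R}) : Prop :=
  mu (~` S) = 0%E /\
  forall (U : set 'rV[R]_k) (phi : 'rV[R]_k -> 'rV[R]_l) (A : set (borel_rV R l)),
    local_param S U phi -> measurable A -> A `<=` phi @` U ->
    mu A = integral_rV
      (fun x => (area_density phi x * \1_(U `&` phi @^-1` A) x)%:E).

(* The Riemannian measure of a closed submanifold is the unique Borel measure
   satisfying [is_area_measure]; the value [mzero] is never used for those. *)
Definition area_measure (R : realType) (k l : nat) (S : set 'rV[R]_l)
  : {measure set (borel_rV R l) -> \bar R} :=
  match pselect (exists mu, is_area_measure k S mu) with
  | left ex_mu => sval (cid ex_mu)
  | right _ => mzero
  end.

Definition gauss_F (R : realType) (k l : nat) (x0 : 'rV[R]_l) (t0 : R)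
  (S : set 'rV[R]_l) : \bar R :=
  (((4 * pi * t0) `^ (k%:R / 2))^-1%:E *
   \int[area_measure k S]_(x in S)
     (expR (- (enorm ((x : 'rV[R]_l) - x0) ^+ 2) / (4 * t0)))%:E)%E.

Definition entropy (R : realType) (k l : nat) (S : set 'rV[R]_l) : \bar R :=
  ereal_sup [set y | exists (x0 : 'rV[R]_l) (t0 : R),
                       0 < t0 /\ y = gauss_F k x0 t0 S].

(* Main.v *)
(* Let [f_s : M -> Sigma_s] be the slices of the family. For [s'] near [s] the map
   [f_s' o f_s^-1 - id] has a small Lipschitz constant on [Sigma_s]; extending it
   to R^l (McShane) gives a bi-Lipschitz homeomorphism [Phi] of R^l, close to an
   isometry, with [Phi Sigma_s = Sigma_s']. If [Phi] and its inverse are [C]- and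
   [D]-Lipschitz, then [Phi] multiplies the area by at most [C ^ k] and
   [|x - y0| <= D |Phi x - Phi y0|], so that
     F_(Phi y0, t) (Sigma_s') <= (C D)^k F_(y0, D^2 t) (Sigma_s),
   whence [entropy Sigma_s' <= (C D)^k entropy Sigma_s], and symmetrically. No
   centre or scale is singled out, so small scales need no separate analysis.
   The entropy of one closed submanifold is finite because locally the area
   measure is pushed by a Lipschitz left inverse of a chart to a measure dominated
   by a multiple of Lebesgue measure, whose Gaussian integrals are explicit.
   No change of variables formula is needed for the existence of the area measure:
   if [Sigma_s] has one, multiplying it by the ratio [J] of the area densities of
   [Phi o phi] and [phi], which is independent of the chart [phi], and pushing it
   by [Phi] gives one for [Sigma_s']. If [Sigma_s] has none, then neither has any
   nearby [Sigma_s'], and the entropies all vanish. *)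

Require Import Defs.
From HB Require Import structures.
From mathcomp Require Import all_boot all_order all_algebra.
From mathcomp Require Import all_classical all_reals all_analysis.
From mathcomp Require Import measurable_realfun ring lra.
Import Order.TTheory GRing.Theory Num.Theory.
Import numFieldNormedType.Exports.
Local Open Scope classical_set_scope.
Local Open Scope ring_scope.

Set Implicit Arguments.
Unset Strict Implicit.
Unset Printing Implicit Defensive.

(** The obstacle is that [Phi] is merely Lipschitz on R^l; only its restriction to the submanifold
    is smooth. Since [smooth_on] and [diffeo] see a map only through its values on the set, charts
    of [Sigma_s] may still be composed with [Phi], and the area bound is read off from difference
    quotients of [Phi \o phi], without differentiating [Phi]. Bounding them in every direction
    compares the two first fundamental forms, and the determinant is monotone on positive definite
    forms: this is the origin of the factor [C ^ k]. The area measure is selected by choice, so the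
    comparison is stated for arbitrary measures satisfying [is_area_measure]. The iterated integral
    in that predicate is rewritten as an integral against a sigma-finite measure on R^k, to which
    monotone convergence and push-forwards apply. A Lipschitz defect q of [Phi - id] in the
    Euclidean norm gives [C = 1 + q] and [D = 1 / (1 - q)], so [(C D) ^ k] tends to 1 with q. The
    defect is uniform over all pairs of points because M x M is compact. *)

Local Notation e_ i := (delta_mx 0 i).

(** * Mean value inequality *)

Lemma ler_rV_norm (R : realType) n (v : 'rV[R]_n) i : `|v 0 i| <= `|v|.
Proof.
by rewrite [leRHS]/Num.Def.normr /= mx_normrE (le_bigmax _ _ (ord0, i)).
Qed.

Lemma rV_norm_le (R : realType) n (v : 'rV[R]_n) (r : R) :
  0 <= r -> (forall i, `|v 0 i| <= r) -> `|v| <= r.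
Proof.
move=> r0 vr; rewrite [leLHS]/Num.Def.normr /= mx_normrE; apply/bigmax_leP.
by split=> // -[i j] _ /=; rewrite ord1.
Qed.

Lemma ball_rV (R : realType) n (x y : 'rV[R]_n) (r : R) :
  0 < r -> ball x r y <-> forall i, `|x 0 i - y 0 i| < r.
Proof.
move=> r0; split; first by move=> [_ xy] i; have := xy 0 i.
by move=> xy; split=> // i j; rewrite (ord1 i); exact: xy.
Qed.

Lemma derivable_line (R : realType) n (f : 'rV[R]_n -> R) w v (t : R) :
  derivable f (w + t *: v) v ->
  is_derive t 1 (fun s => f (w + s *: v)) ('D_v f (w + t *: v)).
Proof.
have E : (fun h : R => h^-1 *: (((fun s => f (w + s *: v)) \o shift t) (h *: 1) -
     f (w + t *: v))) = (fun h => h^-1 *: ((f \o shift (w + t *: v)) (h *: v) -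
     f (w + t *: v))).
  apply/funext => h /=; congr (_ *: (f _ - _)).
  by rewrite [h *: 1]mulr1 scalerDl addrCA.
by move=> df; apply: DeriveDef; rewrite /derivable /derive E.
Qed.

(** The conditions [|t| <= |a|] and [0 <= t * a] say that t lies between 0 and a, whatever the sign
    of a. *)
Lemma lipschitz_line (R : realType) n (f : 'rV[R]_n -> R) w v (a L : R) :
  (forall t, `|t| <= `|a| -> 0 <= t * a -> derivable f (w + t *: v) v) ->
  (forall t, `|t| <= `|a| -> 0 <= t * a -> `|'D_v f (w + t *: v)| <= L) ->
  `|f (w + a *: v) - f w| <= L * `|a|.
Proof.
move=> df dL.
pose g s := f (w + s *: v); pose dg s := 'D_v f (w + s *: v).
have Dg t : `|t| <= `|a| -> 0 <= t * a -> is_derive t 1 g (dg t).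
  by move=> ta t0; apply: derivable_line; apply: df.
have Cg : {in `[Num.min 0 a, Num.max 0 a], forall t, {for t, continuous g}}.
  move=> t; rewrite in_itv /= => /andP[t1 t2].
  apply/differentiable_continuous; rewrite -derivable1_diffP.
  have [a0|a0] := leP 0 a.
    move: t1 t2; rewrite (min_idPl a0) (max_idPr a0) => t1 t2.
    by have [] := Dg t; rewrite ?ger0_norm ?mulr_ge0.
  move: t1 t2; rewrite (min_idPr (ltW a0)) (max_idPl (ltW a0)) => t1 t2.
  have [] := Dg t => //; first by rewrite !ler0_norm ?lerN2 ?(ltW a0).
  by rewrite mulr_le0 ?(ltW a0).
have -> : f w = g 0 by rewrite /g scale0r addr0.
rewrite -/(g a).
have [a0|a0] := leP 0 a.
- have [||c] := @MVT_segment _ g dg 0 a a0.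
  + move=> x; rewrite in_itv /= => /andP[/ltW x1 /ltW x2].
    by apply: Dg; [by rewrite !ger0_norm | exact: mulr_ge0].
  + apply: continuous_in_subspaceT => x; rewrite inE /= => xa.
    by apply: Cg; rewrite (min_idPl a0) (max_idPr a0).
  + rewrite in_itv /= => /andP[c1 c2] ->; rewrite subr0 normrM.
    apply: ler_wpM2r => //; apply: dL; [by rewrite !ger0_norm | exact: mulr_ge0].
- have [||c] := @MVT_segment _ g dg a 0 (ltW a0).
  + move=> x; rewrite in_itv /= => /andP[/ltW x1 /ltW x2].
    by apply: Dg; [by rewrite !ler0_norm ?lerN2 // ltW | by rewrite mulr_le0 // ltW].
  + apply: continuous_in_subspaceT => x; rewrite inE /= => xa.
    by apply: Cg; rewrite (min_idPr (ltW a0)) (max_idPl (ltW a0)).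
  + rewrite in_itv /= => /andP[c1 c2]; rewrite distrC => ->; rewrite sub0r normrM normrN.
    apply: ler_wpM2r => //; apply: dL; [by rewrite !ler0_norm ?lerN2 // ltW | by rewrite mulr_le0 // ltW].
Qed.

(* The sup-norm ball is a box: move from [z] to [y] one coordinate at a time. *)
Lemma lipschitz_partials (R : realType) n (f : 'rV[R]_n -> R) x0 (r L : R) :
  (forall i y, ball x0 r y -> derivable f y (e_ i)) ->
  (forall i y, ball x0 r y -> `|'D_(e_ i) f y| <= L) ->
  forall y z, ball x0 r y -> ball x0 r z ->
  `|f y - f z| <= n%:R * L * `|y - z|.
Proof.
move=> df dL y z yB zB.
have r0 : 0 < r by case: yB.
pose w (p : nat) : 'rV[R]_n := \row_j (if (j < p)%N then y 0 j else z 0 j).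
have wS (p : 'I_n) : w p.+1 = w p + (y 0 p - z 0 p) *: e_ p.
  apply/rowP => j; rewrite !mxE eqxx /= ltnS leq_eqVlt.
  have [->|jp] := eqVneq j p; first by rewrite eqxx ltnn /= mulr1 addrC subrK.
  by rewrite (negbTE (_ : val j != val p)) //= mulr0 addr0.
have wn : w n = y by apply/rowP => j; rewrite mxE ltn_ord.
have w0 : w 0%N = z by apply/rowP => j; rewrite mxE.
have step (p : 'I_n) : `|f (w p.+1) - f (w p)| <= L * `|y - z|.
  have L0 : 0 <= L by apply: le_trans (dL p z zB).
  rewrite wS; apply: (@le_trans _ _ (L * `|y 0 p - z 0 p|)); last first.
    by apply: ler_wpM2l => //; have := ler_rV_norm (y - z) p; rewrite !mxE.
  have wB (t : R) : `|t| <= `|y 0 p - z 0 p| -> 0 <= t * (y 0 p - z 0 p) ->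
      ball x0 r (w p + t *: e_ p).
    move=> ta t0; apply/(ball_rV _ _ r0) => j; rewrite !mxE eqxx /=.
    move/(ball_rV _ _ r0): (yB) => /(_ j) yj; move/(ball_rV _ _ r0): (zB) => /(_ j) zj.
    have [->|jp] := eqVneq j p; last by rewrite mulr0 addr0; case: ifP.
    rewrite ltnn /= mulr1.
    move/(ball_rV _ _ r0): yB => /(_ p) yp; move/(ball_rV _ _ r0): zB => /(_ p) zp.
    move: yp zp; rewrite !ltr_norml => /andP[y1 y2] /andP[z1 z2].
    have [yz|yz] := leP 0 (y 0 p - z 0 p).
      have t0' : 0 <= t.
        move: yz ta t0; rewrite le_eqVlt => /orP[/eqP <-|yz0].
          by rewrite normr0 normr_le0 => /eqP ->.
        by rewrite pmulr_lge0.
      move: ta; rewrite (ger0_norm yz).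
      by rewrite ger0_norm // => ta; apply/andP; split; lra.
    move: ta; rewrite (ltr0_norm yz).
    have t0' : t <= 0 by move: t0; rewrite nmulr_lge0.
    by rewrite ler0_norm // => ta; apply/andP; split; lra.
  by apply: lipschitz_line => t t1 t2; [apply: df | apply: dL]; exact: wB.
have -> : f y - f z = \sum_(p < n) (f (w p.+1) - f (w p)).
  by rewrite -[in LHS]wn -[in LHS]w0 -(telescope_sumr (f \o w) (leq0n n)) big_mkord.
apply: le_trans (ler_norm_sum _ _ _) _.
apply: le_trans (ler_sum _ (fun p _ => step p)) _.
by rewrite sumr_const card_ord -[leLHS]mulr_natl mulrA.
Qed.

(** * Differentiability classes *)

Lemma continuous_rVP (R : realType) (T : topologicalType) n (f : T -> 'rV[R]_n) x :
  {for x, continuous f} <-> forall j, {for x, continuous (fun y => f y 0 j)}.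
Proof.
split=> [cf j|cf].
  apply: (@continuous_comp _ _ _ f (fun M : 'rV[R]_n => M 0 j)) => //.
  exact: coord_continuous.
apply/cvgrPdist_le => /= e e0; near=> y.
apply: rV_norm_le; first exact: ltW.
move=> j; rewrite !mxE; move: j; near: y; apply: filter_forall => j.
by have /cvgrPdist_le/(_ _ e0) := cf j.
Unshelve. all: by end_near. Qed.

Lemma open_near_eq (T : topologicalType) (T' : Type) (U : set T) (f g : T -> T') x :
  open U -> U x -> (forall y, U y -> f y = g y) -> {near x, f =1 g}.
Proof.
move=> oU Ux fg; near=> y; apply: fg; near: y.
exact: (open_nbhs_nbhs (conj oU Ux)).
Unshelve. all: by end_near. Qed.

Lemma near_eq_continuous (T T' : topologicalType) (f g : T -> T') x :
  {near x, f =1 g} -> {for x, continuous f} -> {for x, continuous g}.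
Proof.
move=> fg cf; rewrite /prop_for /continuous_at -(nbhs_singleton fg).
by apply: cvg_trans cf; apply: near_eq_cvg.
Qed.

(** Scalar counterpart of [of_class], made recursive in r so that stability under sums, products and
    composition goes by induction; on open sets [of_classP] identifies the two coordinatewise. *)
Fixpoint Cr (R : realType) n r (U : set 'rV[R]_n) (f : 'rV[R]_n -> R) : Prop :=
  (forall x, U x -> {for x, continuous f}) /\
  if r is r'.+1 then
    forall i, (forall x, U x -> derivable f x (e_ i)) /\ Cr r' U ('D_(e_ i) f)
  else True.

Section Cr_theory.
Context {R : realType} {n : nat}.
Implicit Types (U V : set 'rV[R]_n) (f g : 'rV[R]_n -> R).

Lemma Cr_continuous r U f x : Cr r U f -> U x -> {for x, continuous f}.
Proof. by case: r => [|r] [cf _] /cf. Qed.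

Lemma Cr_eq r U f g : open U -> (forall x, U x -> f x = g x) ->
  Cr r U f -> Cr r U g.
Proof.
move=> oU; elim: r f g => [|r IH] f g fg [cf df].
  by split=> // x Ux; apply: near_eq_continuous (cf x Ux); exact: (open_near_eq oU).
split=> [x Ux|i].
  by apply: near_eq_continuous (cf x Ux); exact: (open_near_eq oU).
have [dfi Cf] := df i; split=> [x Ux|].
  by apply: near_eq_derivable (dfi x Ux); exact: (open_near_eq oU).
by apply: IH Cf => x Ux; apply: near_eq_derive; exact: (open_near_eq oU).
Qed.

Lemma Cr_sub r U V f : V `<=` U -> Cr r U f -> Cr r V f.
Proof.
move=> VU; elim: r f => [|r IH] f [cf df]; split=> //; try by move=> x /VU /cf.
by move=> i; have [dfi Cf] := df i; split; [move=> x /VU /dfi | exact: IH].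
Qed.

Lemma CrW r U f : Cr r.+1 U f -> Cr r U f.
Proof.
elim: r f => [|r IH] f [cf df]; split=> // i.
by have [dfi Cf] := df i; split=> //; exact: IH.
Qed.

Lemma Cr_cst r U (c : R) : Cr r U (cst c).
Proof.
elim: r c => [|r IH] c; split=> //; try by (move=> x _; exact: cst_continuous).
move=> i; split=> [x _|]; first exact: derivable_cst.
have -> : 'D_(e_ i) (cst c) = cst 0 :> ('rV[R]_n -> R).
  by apply/funext => x; rewrite derive_cst.
exact: IH.
Qed.

Lemma CrD r U f g : open U -> Cr r U f -> Cr r U g -> Cr r U (fun x => f x + g x).
Proof.
move=> oU; elim: r f g => [|r IH] f g [cf df] [cg dg]; split=> //;
  try by (move=> x Ux; apply: continuousD; [exact: cf | exact: cg]).
move=> i; have [dfi Cf] := df i; have [dgi Cg] := dg i; split.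
  by move=> x Ux; apply: derivableD; [exact: dfi | exact: dgi].
apply: Cr_eq (IH _ _ Cf Cg) => // x Ux.
by rewrite /= [RHS]deriveD; [|exact: dfi | exact: dgi].
Qed.

Lemma CrM r U f g : open U -> Cr r U f -> Cr r U g -> Cr r U (fun x => f x * g x).
Proof.
move=> oU; elim: r f g => [|r IH] f g Cf Cg; have [cf df] := Cf; have [cg dg] := Cg;
  split=> //; try by (move=> x Ux; apply: continuousM; [exact: cf | exact: cg]).
move=> i; have [dfi Cfi] := df i; have [dgi Cgi] := dg i; split.
  by move=> x Ux; apply: derivableM; [exact: dfi | exact: dgi].
apply: Cr_eq (CrD oU (IH _ _ (CrW Cf) Cgi) (IH _ _ (CrW Cg) Cfi)) => // x Ux.
by rewrite /= [RHS]deriveM; [|exact: dfi | exact: dgi].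
Qed.

Lemma Cr_sum r U m (f : 'I_m -> 'rV[R]_n -> R) : open U ->
  (forall j, Cr r U (f j)) -> Cr r U (fun x => \sum_(j < m) f j x).
Proof.
move=> oU; elim: m f => [|m IH] f Cf.
  apply: Cr_eq (Cr_cst r U 0) => // x _; by rewrite big_ord0.
apply: Cr_eq (CrD oU (IH (fun j => f (widen_ord (leqnSn m) j)) _) (Cf ord_max)) => //.
by move=> x _; rewrite big_ord_recr.
Qed.

End Cr_theory.

(** * Differentiability from continuous partial derivatives *)

Section differentiability.
Context {R : realType}.

(** Subtracting the linear map [l] with the partials of f at x leaves a function whose partials are
    small near x, by continuity; the mean value inequality then bounds its increments. *)
Lemma Cr1_expansion n (U : set 'rV[R]_n) (f : 'rV[R]_n -> R) x :
  open U -> U x -> Cr 1 U f ->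
  forall e, 0 < e -> \forall y \near x,
    `|f y - f x - \sum_i (y - x) 0 i * 'D_(e_ i) f x| <= e * `|y - x|.
Proof.
move=> oU Ux [cf df] e e0.
(* The denominator absorbs the factor n of [lipschitz_partials]; [n.+1] keeps it nonzero when n =
   0. *)
pose e' := e / n.+1%:R.
have e'0 : 0 < e' by rewrite divr_gt0.
have /nbhs_ballP[d /= d0 dU] : nbhs x (fun y => U y /\
    forall i, `|'D_(e_ i) f y - 'D_(e_ i) f x| <= e').
  near=> y; split.
    by near: y; exact: (open_nbhs_nbhs (conj oU Ux)).
  move=> i; move: i; near: y; apply: filter_forall => i.
  have [_ [cdf _]] := df i.
  have /cvgrPdist_le/(_ _ e'0) := cdf x Ux.
  by apply: filterS => y; rewrite distrC.
pose l (y : 'rV[R]_n) := \sum_i y 0 i * 'D_(e_ i) f x.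
have Dl y i : is_derive y (e_ i) l ('D_(e_ i) f x).
  have E : (fun h : R => h^-1 *: ((l \o shift y) (h *: e_ i) - l y)) @ 0^' -->
      'D_(e_ i) f x.
    apply: cvg_near_cst; rewrite near_withinE; near=> h => h0.
    rewrite /l /= -sumrB.
    under eq_bigr => j _ do rewrite -mulrBl !mxE eqxx /= addrK.
    rewrite (bigD1 i) //= eqxx mulr1 big1 ?addr0 => [|j /negbTE ->].
      by rewrite /GRing.scale /= mulrA mulVf // mul1r.
    by rewrite mulr0 mul0r.
  by split; [exact: cvgP E | exact: cvg_lim].
pose h y := f y - l y.
have Dh y i : ball x d y -> is_derive y (e_ i) h ('D_(e_ i) f y - 'D_(e_ i) f x).
  move=> /dU[Uy _]; have [dfi _] := df i.
  by apply: is_deriveB; apply: derivableP; exact: dfi.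
apply/nbhs_ballP; exists d => //= y yB.
have := @lipschitz_partials R n h x d e' _ _ y x yB (ballxx _ d0).
have -> : h y - h x = f y - f x - \sum_i (y - x) 0 i * 'D_(e_ i) f x.
  have -> : \sum_i (y - x) 0 i * 'D_(e_ i) f x = l y - l x.
    by rewrite /l -sumrB; apply: eq_bigr => i _; rewrite !mxE mulrBl.
  by rewrite /h; ring.
move=> H; apply: le_trans (H _ _) _.
- by move=> i z zB; have [] := Dh z i zB.
- move=> i z zB; have [_ ->] := Dh z i zB.
  by have [_] := dU z zB; exact.
- apply: ler_wpM2r => //.
  by rewrite /e' mulrC -mulrA ler_piMr ?(ltW e0)// mulrC ler_pdivrMr // mul1r ler_nat.
Unshelve. all: by end_near. Qed.

Lemma differentiable_flat (V W : normedModType R) (h : V -> W) x :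
  (forall e, 0 < e -> \forall y \near x, `|h y - h x| <= e * `|y - x|) ->
  differentiable h x.
Proof.
move=> hx.
have hE : h \o shift x = cst (h x) + \0 +o_ 0 id.
  apply/eqaddoP => e e0.
  have := hx e e0; rewrite (near_shift 0) /=; apply: filterS => y /=.
  rewrite subr0 addrK; apply: le_trans.
  rewrite le_eqVlt; apply/orP; left; apply/eqP; congr (`|_|).
  by rewrite {1}/GRing.add /GRing.opp /= /GRing.add /= addr0.
have c0 : continuous (\0 : V -> W) by move=> y; exact: cvg_cst.
have dh0 := diff_unique c0 hE.
by apply/diff_locallyP; rewrite dh0.
Qed.

(** By the expansion, f is a linear combination of coordinates plus a function whose increments from
    x are o(|y - x|), hence differentiable with zero differential. *)
Lemma Cr1_differentiable n (U : set 'rV[R]_n) (f : 'rV[R]_n -> R) x :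
  open U -> U x -> Cr 1 U f -> differentiable f x.
Proof.
move=> oU Ux Cf.
pose l (y : 'rV[R]_n) := \sum_i y 0 i * 'D_(e_ i) f x.
have dl : differentiable l x.
  rewrite (_ : l = \sum_i (fun y : 'rV[R]_n => y 0 i * 'D_(e_ i) f x)); last first.
    by apply/funext => y; rewrite /l fct_sumE.
  apply: differentiable_sum => i; apply: differentiableM => //.
  exact: differentiable_coord.
pose h y := f y - l y.
have dh : differentiable h x.
  apply: differentiable_flat => e e0.
  apply: filterS (Cr1_expansion oU Ux Cf e0) => y; apply: le_trans.
  have -> : \sum_i (y - x) 0 i * 'D_(e_ i) f x = l y - l x.
    by rewrite /l -sumrB; apply: eq_bigr => i _; rewrite !mxE mulrBl.
  by rewrite le_eqVlt; apply/orP; left; apply/eqP; congr (`|_|); rewrite /h; ring.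
rewrite (_ : f = h + l); first exact: differentiableD.
by apply/funext => y; rewrite /h /= /GRing.add /= subrK.
Qed.

Lemma Cr1_derive n (U : set 'rV[R]_n) (f : 'rV[R]_n -> R) x v :
  open U -> U x -> Cr 1 U f -> 'D_v f x = \sum_i v 0 i * 'D_(e_ i) f x.
Proof.
move=> oU Ux Cf; have df := Cr1_differentiable oU Ux Cf.
rewrite deriveE // {1}(row_sum_delta v) linear_sum /=; apply: eq_bigr => i _.
by rewrite linearZ /= deriveE.
Qed.
End differentiability.

(** * Composition of C^r maps, smooth maps on subsets, diffeomorphisms *)

Section classes.
Context {R : realType}.

Lemma Cr_local n r (U : set 'rV[R]_n) (f : 'rV[R]_n -> R) :
  (forall x, U x -> exists V, [/\ open V, V x & Cr r V f]) -> Cr r U f.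
Proof.
elim: r f => [|r IH] f loc.
  by split=> // x Ux; have [V [_ Vx [cf _]]] := loc x Ux; exact: cf.
split=> [x Ux|i]; first by have [V [_ Vx [cf _]]] := loc x Ux; exact: cf.
split=> [x Ux|].
  by have [V [_ Vx [_ df]]] := loc x Ux; have [dfi _] := df i; exact: dfi.
apply: IH => x Ux; have [V [oV Vx [_ df]]] := loc x Ux.
by exists V; split=> //; have [_] := df i.
Qed.

Lemma Cr1W n r (U : set 'rV[R]_n) (f : 'rV[R]_n -> R) : Cr r.+1 U f -> Cr 1 U f.
Proof. by elim: r => // r IH /CrW. Qed.

(** [partials] is a right fold, so the last index of the list is differentiated first; peeling off
    that index passes from f to [partial i f]. *)
Lemma of_classS n m r (U : set 'rV[R]_n) (f : 'rV[R]_n -> 'rV[R]_m) :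
  of_class r.+1 U f <->
  [/\ forall x, U x -> {for x, continuous f},
      forall i x, U x -> derivable f x (e_ i) &
      forall i, of_class r U (partial i f)].
Proof.
split=> [Cf|[cf df Cf] s x].
  split=> [x Ux|i x Ux|i s x sr Ux].
  - by have [] := Cf [::] x isT Ux.
  - by have [_ /(_ isT)] := Cf [::] x isT Ux; exact.
  - by have := Cf (rcons s i) x; rewrite /partials foldr_rcons size_rcons; exact.
- case: (lastP s) => [|s' i] sr Ux; first by split=> [|_ i]; [exact: cf|exact: df].
  by rewrite size_rcons /partials foldr_rcons in sr *; exact: Cf.
Qed.

Lemma of_classP n m r (U : set 'rV[R]_n) (f : 'rV[R]_n -> 'rV[R]_m) : open U ->
  of_class r U f <-> forall j, Cr r U (fun x => f x 0 j).
Proof.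
move=> oU; elim: r f => [|r IH] f; split.
- move=> Cf j; split=> // x Ux; move: j; apply/continuous_rVP.
  by have [] := Cf [::] x isT Ux.
- move=> Cf [|//] x _ Ux; split=> //; apply/continuous_rVP => j.
  by have [cf _] := Cf j; exact: cf.
- move=> /of_classS[cf df Cf] j; split=> [x Ux|i].
    by move: j; apply/continuous_rVP; exact: cf.
  split=> [x Ux|]; first by have /derivable_mxP := df i x Ux; exact.
  have /IH/(_ j) := Cf i; apply: Cr_eq => // x Ux.
  by rewrite /partial derive_mx ?mxE; last exact: df.
- move=> Cf; have df i x : U x -> derivable f x (e_ i).
    move=> Ux; apply/derivable_mxP => a j; rewrite (ord1 a).
    by have [_ /(_ i)[dfi _]] := Cf j; exact: dfi.
  apply/of_classS; split=> // [x Ux|i].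
    by apply/continuous_rVP => j; have [cf _] := Cf j; exact: cf.
  apply/IH => j; have [_ /(_ i)[_]] := Cf j; apply: Cr_eq => // x Ux.
  by rewrite /partial derive_mx ?mxE; last exact: df.
Qed.

Lemma Cr1_differentiable_rV n m (U : set 'rV[R]_n) (f : 'rV[R]_n -> 'rV[R]_m) x :
  open U -> U x -> (forall j, Cr 1 U (fun x => f x 0 j)) -> differentiable f x.
Proof.
move=> oU Ux Cf.
rewrite (_ : f = \sum_j (fun y => f y 0 j *: (e_ j : 'rV[R]_m))).
  apply: differentiable_sum => j; apply: differentiableZl.
  exact: (Cr1_differentiable oU Ux (Cf j)).
by apply/funext => y; rewrite fct_sumE [LHS]row_sum_delta.
Qed.

(** By the chain rule each partial of [g \o f] is a sum of products of a partial of g composed with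
    f, covered by the induction hypothesis, and a partial of f. *)
Lemma Cr_comp n m r (U : set 'rV[R]_n) (V : set 'rV[R]_m)
    (f : 'rV[R]_n -> 'rV[R]_m) (g : 'rV[R]_m -> R) :
  open U -> open V -> (forall x, U x -> V (f x)) ->
  (forall j, Cr r U (fun x => f x 0 j)) -> Cr r V g -> Cr r U (g \o f).
Proof.
move=> oU oV UV; elim: r g => [|r IH] g Cf Cg.
  split=> // x Ux; apply: continuous_comp.
    by apply/continuous_rVP => j; exact: Cr_continuous (Cf j) Ux.
  exact: Cr_continuous Cg (UV _ Ux).
have df x : U x -> differentiable f x.
  by move=> Ux; apply: (Cr1_differentiable_rV oU Ux) => j; exact: Cr1W (Cf j).
have dg y : V y -> differentiable g y.
  by move=> Vy; exact: (Cr1_differentiable oV Vy (Cr1W Cg)).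
have dgf x : U x -> differentiable (g \o f) x.
  by move=> Ux; apply: differentiable_comp; [exact: df|exact/dg/UV].
split=> [x Ux|i]; first exact/differentiable_continuous/dgf.
split=> [x Ux|]; first exact/diff_derivable/dgf.
apply: (@Cr_eq _ _ r U
    (fun x => \sum_j ('D_(e_ j) g \o f) x * 'D_(e_ i) (fun x => f x 0 j) x)) => //.
  move=> x Ux; rewrite deriveE; last exact: dgf.
  rewrite diff_comp; [|exact: df|exact/dg/UV].
  rewrite /= -deriveE; last exact/dg/UV.
  rewrite (Cr1_derive _ oV (UV _ Ux) (Cr1W Cg)); apply: eq_bigr => j _ /=.
  rewrite mulrC -deriveE; last exact: df.
  by rewrite derive_mx ?mxE //; exact/diff_derivable/df.
apply: Cr_sum => // j; apply: CrM => //.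
  by apply: IH => [k|]; [exact: CrW (Cf k)|have [_ /(_ j)[]] := Cg].
by have [_ /(_ i)[]] := Cf j.
Qed.

Lemma open_preimage_on (T T' : topologicalType) (U : set T) (V : set T') (f : T -> T') :
  open U -> open V -> (forall x, U x -> {for x, continuous f}) ->
  open (U `&` f @^-1` V).
Proof.
move=> oU oV cf; rewrite openE => x [Ux Vfx].
apply: filterI; first exact: (open_nbhs_nbhs (conj oU Ux)).
by apply: (cf x Ux); exact: (open_nbhs_nbhs (conj oV Vfx)).
Qed.

Lemma of_class_continuous n m r (U : set 'rV[R]_n) (f : 'rV[R]_n -> 'rV[R]_m) x :
  of_class r U f -> U x -> {for x, continuous f}.
Proof. by move=> Cf Ux; have [] := Cf [::] x isT Ux. Qed.

Lemma smooth_on_eq n m (A : set 'rV[R]_n) (f g : 'rV[R]_n -> 'rV[R]_m) :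
  (forall x, A x -> f x = g x) -> smooth_on A f -> smooth_on A g.
Proof.
move=> fg sf x Ax; have [U [h [oU Ux Ch fh]]] := sf x Ax.
by exists U, h; split=> // y Ay Uy; rewrite -fg // fh.
Qed.

Lemma smooth_on_sub n m (A B : set 'rV[R]_n) (f : 'rV[R]_n -> 'rV[R]_m) :
  B `<=` A -> smooth_on A f -> smooth_on B f.
Proof.
move=> BA sf x Bx; have [U [h [oU Ux Ch fh]]] := sf x (BA _ Bx).
by exists U, h; split=> // y /BA Ay Uy; rewrite fh.
Qed.

Lemma smooth_on_comp n m p (A : set 'rV[R]_n) (B : set 'rV[R]_m)
    (f : 'rV[R]_n -> 'rV[R]_m) (g : 'rV[R]_m -> 'rV[R]_p) :
  (forall x, A x -> B (f x)) -> smooth_on A f -> smooth_on B g ->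
  smooth_on A (g \o f).
Proof.
move=> AB sf sg x Ax.
have [U [h [oU Ux Ch fh]]] := sf x Ax.
have [V [k [oV Vx Ck gk]]] := sg _ (AB x Ax).
pose W := U `&` h @^-1` V.
have oW : open W.
  by apply: open_preimage_on => // y Uy; exact: of_class_continuous (Ch 0%N) Uy.
exists W, (k \o h); split=> //.
- by split=> //=; rewrite -fh.
- move=> r; apply/of_classP => // j.
  apply: (@Cr_comp _ _ r W V h (fun y => k y 0 j)) => //.
  + by move=> y [].
  + by move=> i; apply: (@Cr_sub _ _ _ U) => [y []//|]; exact: ((of_classP r h oU).1 (Ch r)).
  + exact: ((of_classP r k oV).1 (Ck r)).
- move=> y Ay [Uy Vy] /=; rewrite fh // gk // -fh //; exact: AB.
Qed.

Lemma diffeo_comp n m p (A : set 'rV[R]_n) (B : set 'rV[R]_m) (C : set 'rV[R]_p)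
    (f : 'rV[R]_n -> 'rV[R]_m) (g : 'rV[R]_m -> 'rV[R]_p) :
  diffeo A B f -> diffeo B C g -> diffeo A C (g \o f).
Proof.
move=> [<- sf [f' sf' f'K]] [<- sg [g' sg' g'K]]; split.
- by rewrite image_comp.
- by apply: smooth_on_comp sf sg => x Ax; exists x.
- exists (f' \o g').
    by apply: smooth_on_comp sg' sf' => _ [_ [x Ax <-] <-]; rewrite g'K; exists x.
  by move=> x Ax /=; rewrite g'K ?f'K //; exists x.
Qed.

Lemma diffeo_sub n m (A A' : set 'rV[R]_n) (B : set 'rV[R]_m)
    (f : 'rV[R]_n -> 'rV[R]_m) :
  A' `<=` A -> diffeo A B f -> diffeo A' (f @` A') f.
Proof.
move=> AA [<- sf [g sg gK]]; split=> //; first exact: smooth_on_sub sf.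
exists g; first by apply: smooth_on_sub sg => _ [x /AA Ax <-]; exists x.
by move=> x /AA; exact: gK.
Qed.

(** Any left inverse g of f on A agrees on B with the smooth inverse, and smoothness on B depends
    only on values on B. This applies to maps such as the Lipschitz inverse [Psi]. *)
Lemma diffeo_inv n m (A : set 'rV[R]_n) (B : set 'rV[R]_m)
    (f : 'rV[R]_n -> 'rV[R]_m) g :
  diffeo A B f -> (forall x, A x -> g (f x) = x) -> diffeo B A g.
Proof.
move=> [<- sf [h sh hK]] gK; split.
- rewrite eqEsubset; split=> [_ [_ [x Ax <-] <-]|x Ax]; first by rewrite gK.
  by exists (f x); [exists x|exact: gK].
- by apply: smooth_on_eq sh => _ [x Ax <-]; rewrite gK // hK.
- by exists f => // _ [x Ax <-]; rewrite gK.
Qed.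

Lemma diffeo_eq n m (A : set 'rV[R]_n) (B : set 'rV[R]_m)
    (f g : 'rV[R]_n -> 'rV[R]_m) :
  (forall x, A x -> f x = g x) -> diffeo A B f -> diffeo A B g.
Proof.
move=> fg [<- sf [h sh hK]]; split; last 1 first.
- by exists h => // x Ax; rewrite -fg // hK.
- by apply: eq_imagel => x Ax; rewrite fg.
- exact: smooth_on_eq sf.
Qed.

Lemma smooth_on_open n m r (U : set 'rV[R]_n) (f : 'rV[R]_n -> 'rV[R]_m) j :
  open U -> smooth_on U f -> Cr r U (fun x => f x 0 j).
Proof.
move=> oU sf; apply: Cr_local => x Ux; have [V [g [oV Vx Cg fg]]] := sf x Ux.
exists (U `&` V); split=> //; first exact: openI.
have Cgj : Cr r V (fun x => g x 0 j) by exact: ((of_classP r g oV).1 (Cg r)).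
apply: Cr_eq (Cr_sub (@subIsetr _ U V) Cgj); first exact: openI.
by move=> y [Uy Vy]; rewrite fg.
Qed.

Lemma smooth_on_differentiable n m (U : set 'rV[R]_n) (f : 'rV[R]_n -> 'rV[R]_m) x :
  open U -> smooth_on U f -> U x -> differentiable f x.
Proof.
by move=> oU sf Ux; apply: (Cr1_differentiable_rV oU Ux) => j; exact: smooth_on_open.
Qed.

Lemma of_class_lipschitz n m (U : set 'rV[R]_n) (f : 'rV[R]_n -> 'rV[R]_m) x :
  open U -> U x -> of_class 1 U f ->
  exists2 r : R, 0 < r & exists2 L : R, 0 < L &
    forall y z, ball x r y -> ball x r z -> `|f y - f z| <= L * `|y - z|.
Proof.
move=> oU Ux /(of_classP _ _ oU) Cf.
(* One more than every partial derivative at x in absolute value, hence a bound for all of them on a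
   neighbourhood. *)
pose K : R := \big[Num.max/0]_(ij : 'I_n * 'I_m)
   `|'D_(e_ ij.1) (fun x => f x 0 ij.2) x| + 1.
have : nbhs x [set y | U y /\ forall ij : 'I_n * 'I_m,
    `|'D_(e_ ij.1) (fun x => f x 0 ij.2) y| <= K].
  near=> y; split; first by near: y; exact: (open_nbhs_nbhs (conj oU Ux)).
  move=> ij; move: ij; near: y; apply: filter_forall => -[i j] /=.
  have [_ /(_ i)[_ [cD _]]] := Cf j.
  have /cvgrPdist_le/(_ _ ltr01) := cD x Ux; apply: filterS => y.
  rewrite distrC => Dy.
  rewrite -[X in `|X|](subrK ('D_(e_ i) (fun x => f x 0 j) x)) addrC.
  apply: le_trans (ler_normD _ _) _; apply: lerD => //.
  exact: (le_bigmax _ (fun ij : 'I_n * 'I_m => `|'D_(e_ ij.1) (fun x => f x 0 ij.2) x|) (i, j)).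
move=> /nbhs_ballP[r /= r0 rU].
have K0 : 0 < K.
  rewrite ltr_wpDl //; exact: bigmax_ge_id.
exists r => //; exists (n%:R * K + 1); first by rewrite ltr_wpDl // mulr_ge0 // ltW.
move=> y z yB zB; apply: rV_norm_le => [|j].
  by rewrite mulr_ge0 // addr_ge0 // mulr_ge0 // ltW.
rewrite !mxE; apply: le_trans (@lipschitz_partials R n (fun x => f x 0 j) x r K _ _ y z yB zB) _.
- by move=> i w /rU[Uw _]; have [_ /(_ i)[dfi _]] := Cf j; exact: dfi.
- by move=> i w /rU[_ /(_ (i, j))].
- by rewrite ler_wpM2r // lerDl.
Unshelve. all: by end_near. Qed.

Lemma smooth_on_lipschitz n m (A : set 'rV[R]_n) (f : 'rV[R]_n -> 'rV[R]_m) x :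
  smooth_on A f -> A x ->
  exists2 r : R, 0 < r & exists2 L : R, 0 < L &
    forall y z, A y -> A z -> ball x r y -> ball x r z ->
      `|f y - f z| <= L * `|y - z|.
Proof.
move=> sf Ax; have [U [g [oU Ux Cg fg]]] := sf x Ax.
have [r r0 [L L0 gL]] := of_class_lipschitz oU Ux (Cg 1%N).
have : nbhs x U by exact: (open_nbhs_nbhs (conj oU Ux)).
move=> /nbhs_ballP[d /= d0 dU].
exists (Num.min r d); first by rewrite lt_min r0.
exists L => // y z Ay Az yB zB.
have le1 : Num.min r d <= r by rewrite ge_min lexx.
have le2 : Num.min r d <= d by rewrite ge_min lexx orbT.
rewrite !fg //; try (by apply/dU; exact: le_ball le2 _ _).
by apply: gL; exact: le_ball le1 _ _.
Qed.

End classes.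

(** * Euclidean norm and quadratic forms *)

Section enorm_theory.
Context {R : realType} {n : nat}.
Implicit Types u v w : 'rV[R]_n.

Lemma enorm_ge0 v : 0 <= enorm v. Proof. exact: sqrtr_ge0. Qed.

Lemma enorm_sqr v : enorm v ^+ 2 = \sum_j v 0 j ^+ 2.
Proof. by rewrite sqr_sqrtr // sumr_ge0 // => j _; exact: sqr_ge0. Qed.

Lemma enorm0 : enorm (0 : 'rV[R]_n) = 0.
Proof.
by rewrite /enorm big1 ?sqrtr0 // => j _; rewrite mxE expr0n.
Qed.

Lemma enormZ (a : R) v : enorm (a *: v) = `|a| * enorm v.
Proof.
rewrite /enorm -sqrtr_sqr -sqrtrM ?sqr_ge0 // mulr_sumr.
by congr Num.sqrt; apply: eq_bigr => j _; rewrite mxE exprMn.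
Qed.

Lemma enormN v : enorm (- v) = enorm v.
Proof. by rewrite -scaleN1r enormZ normrN1 mul1r. Qed.

Lemma enormB u v : enorm (u - v) = enorm (v - u).
Proof. by rewrite -enormN opprB. Qed.

Lemma norm_le_enorm v : `|v| <= enorm v.
Proof.
apply: rV_norm_le => [|i]; first exact: enorm_ge0.
rewrite -sqrtr_sqr ler_sqrt; last by rewrite sumr_ge0 // => j _; exact: sqr_ge0.
by rewrite (bigD1 i) //= lerDl sumr_ge0 // => j _; exact: sqr_ge0.
Qed.

Lemma enorm_le_norm v : enorm v <= n%:R * `|v|.
Proof.
have nv0 : 0 <= n%:R * `|v| by rewrite mulr_ge0.
rewrite -(ler_pXn2r (n := 2)) ?nnegrE ?enorm_ge0 // enorm_sqr exprMn.
apply: (@le_trans _ _ (\sum_(j < n) `|v| ^+ 2)).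
  apply: ler_sum => j _; rewrite -[v 0 j ^+ 2]real_normK ?num_real //.
  by rewrite ler_pXn2r ?nnegrE // ler_rV_norm.
rewrite sumr_const card_ord -[leLHS]mulr_natl; apply: ler_wpM2r; first exact: sqr_ge0.
by rewrite -natrX ler_nat; case: (n) => // m; rewrite leq_pmulr.
Qed.

(** Cauchy-Schwarz, by expanding the square of the norm of [enorm v *: u - enorm u *: v]. The case
    of a zero vector is separate because the product of the norms is cancelled at the end. *)
Lemma dot_le_enorm u v : \sum_j u 0 j * v 0 j <= enorm u * enorm v.
Proof.
have u0 := enorm_ge0 u; have v0 := enorm_ge0 v.
have [|uv] := leP (enorm u * enorm v) 0.
  rewrite le_eqVlt ltNge mulr_ge0 // orbF mulf_eq0 => /orP[] /eqP w0.
    rewrite w0 mul0r big1 // => j _; have := norm_le_enorm u.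
    by rewrite w0 normr_le0 => /eqP ->; rewrite mxE mul0r.
  rewrite w0 mulr0 big1 // => j _; have := norm_le_enorm v.
  by rewrite w0 normr_le0 => /eqP ->; rewrite mxE mulr0.
have H : 0 <= \sum_j (enorm v * u 0 j - enorm u * v 0 j) ^+ 2.
  by apply: sumr_ge0 => j _; exact: sqr_ge0.
have E : \sum_j (enorm v * u 0 j - enorm u * v 0 j) ^+ 2 =
    enorm v ^+ 2 * (\sum_j u 0 j ^+ 2) + enorm u ^+ 2 * (\sum_j v 0 j ^+ 2) -
    2 * (enorm u * enorm v) * \sum_j u 0 j * v 0 j.
  rewrite !mulr_sumr -big_split -sumrB /=.
  by apply: eq_bigr => j _; ring.
rewrite -!enorm_sqr in E.
rewrite E in H.
rewrite -(ler_pM2l uv); nra.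
Qed.

Lemma ler_enormD u v : enorm (u + v) <= enorm u + enorm v.
Proof.
have u0 := enorm_ge0 u; have v0 := enorm_ge0 v.
rewrite -(ler_pXn2r (n := 2)) ?nnegrE ?enorm_ge0 ?addr_ge0 //.
have -> : enorm (u + v) ^+ 2 = enorm u ^+ 2 + enorm v ^+ 2 + 2 * \sum_j u 0 j * v 0 j.
  rewrite !enorm_sqr mulr_sumr -!big_split /=.
  by apply: eq_bigr => j _; rewrite mxE; ring.
have := dot_le_enorm u v; nra.
Qed.

Lemma ler_enormB u v : enorm u - enorm v <= enorm (u - v).
Proof. by rewrite lerBlDr; have := ler_enormD (u - v) v; rewrite subrK. Qed.

Lemma enorm_eq0 v : enorm v = 0 -> v = 0.
Proof.
by move=> v0; apply/eqP; rewrite -normr_le0 -v0; exact: norm_le_enorm.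
Qed.

Lemma enorm_gt0 v : v != 0 -> 0 < enorm v.
Proof.
move=> v0; rewrite lt_def enorm_ge0 andbT; apply: contraNneq v0 => /enorm_eq0 ->.
by [].
Qed.

End enorm_theory.

Section quadratic_forms.
Context {R : realType}.

Definition qform n (A : 'M[R]_n) (v : 'rV[R]_n) : R := (v *m A *m v^T) 0 0.

Lemma qform_gram k l (J : 'M[R]_(k, l)) v : qform (J *m J^T) v = enorm (v *m J) ^+ 2.
Proof.
rewrite enorm_sqr /qform mulmxA -mulmxA -trmx_mul mxE.
by apply: eq_bigr => j _; rewrite !mxE expr2.
Qed.

Lemma mulmx_trC n (u v : 'rV[R]_n) : u *m v^T = v *m u^T.
Proof.
rewrite -[u *m v^T]trmxK trmx_mul trmxK.
by apply/matrixP => i j; rewrite !ord1 mxE.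
Qed.

Lemma qform_block n (a : R) (b : 'rV[R]_n) (M : 'M[R]_n) (s : R) (y : 'rV[R]_n) :
  qform (block_mx (a%:M : 'M[R]_1) b b^T M) (row_mx s%:M y) =
  a * s ^+ 2 + 2 * s * (b *m y^T) 0 0 + qform M y.
Proof.
rewrite /qform mul_row_block tr_row_mx mul_row_col !mulmxDl.
rewrite tr_scalar_mx !mul_mx_scalar !mul_scalar_mx -!scalemxAl (mulmx_trC y b).
set p := b *m y^T; set q := y *m M *m y^T.
rewrite !mxE !eqxx !mulr1n.
ring.
Qed.

Lemma det_schur n (a : R) (b : 'rV[R]_n) (M : 'M[R]_n) : a != 0 ->
  \det (block_mx (a%:M : 'M[R]_1) b b^T M) = a * \det (M - a^-1 *: (b^T *m b)).
Proof.
move=> a0.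
have -> : block_mx (a%:M : 'M[R]_1) b b^T M =
    block_mx 1%:M 0 (a^-1 *: b^T) 1%:M *m
    block_mx (a%:M : 'M[R]_1) b 0 (M - a^-1 *: (b^T *m b)).
  rewrite mulmx_block !mul0mx !mulmx0 !mul1mx !addr0 ?add0r -!scalemxAl.
  by rewrite mul_mx_scalar scalerA mulVf // scale1r addrC subrK.
by rewrite det_mulmx det_lblock det_ublock !det1 mul1r det_scalar1 mul1r.
Qed.

(** Completing the square in the first coordinate; what remains is the Schur complement evaluated at
    y. *)
Lemma qform_schur n (a : R) (b : 'rV[R]_n) (M : 'M[R]_n) (s : R) (y : 'rV[R]_n) :
  a != 0 ->
  qform (block_mx (a%:M : 'M[R]_1) b b^T M) (row_mx s%:M y) =
  a * (s + (b *m y^T) 0 0 / a) ^+ 2 + qform (M - a^-1 *: (b^T *m b)) y.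
Proof.
move=> a0; rewrite qform_block.
have -> : qform (M - a^-1 *: (b^T *m b)) y = qform M y - a^-1 * (b *m y^T) 0 0 ^+ 2.
  have by_sym := mulmx_trC y b.
  rewrite /qform mulmxBr mulmxBl -scalemxAr -scalemxAl [LHS]mxE; congr (_ + _).
  rewrite [LHS]mxE; congr (- _); rewrite [LHS]mxE; congr (_ * _).
  rewrite (mulmxA y) -(mulmxA _ b) by_sym.
  by rewrite {1}[b *m y^T]mx11_scalar mul_scalar_mx mxE expr2.
by field.
Qed.

(* Schur complements are infima of the form over the eliminated variable, hence
   monotone in the form. *)
Lemma det_posdef_le n (A B : 'M[R]_n) : A^T = A -> B^T = B ->
  (forall v, v != 0 -> 0 < qform A v) -> (forall v, qform A v <= qform B v) ->
  0 < \det A <= \det B.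
Proof.
elim: n A B => [|n IH] A B; first by rewrite !det_mx00 ltr01 lexx.
rewrite -[n.+1]/(1 + n)%N in A B *.
have E (C : 'M[R]_(1 + n)) : C^T = C -> C = block_mx (ulsubmx C 0 0)%:M (ursubmx C) (ursubmx C)^T (drsubmx C).
  by move=> Cs; rewrite trmx_ursub Cs -mx11_scalar submxK.
move=> As Bs; rewrite (E _ As) (E _ Bs).
have Ms : (drsubmx A)^T = drsubmx A by rewrite trmx_drsub As.
have M's : (drsubmx B)^T = drsubmx B by rewrite trmx_drsub Bs.
move: Ms M's; clear As Bs.
set a := ulsubmx A 0 0; set b := ursubmx A; set M := drsubmx A.
set a' := ulsubmx B 0 0; set b' := ursubmx B; set M' := drsubmx B.
move=> Ms M's Apos AB.
have row0 (s : R) (y : 'rV[R]_n) : (row_mx (s%:M : 'M[R]_1) y == 0) = (s == 0) && (y == 0).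
  rewrite row_mx_eq0; congr (_ && _).
  by apply/eqP/eqP => [/matrixP/(_ 0 0)|->]; rewrite ?raddf0 // !mxE eqxx.
have Bpos v : v != 0 -> 0 < qform (block_mx (a'%:M : 'M[R]_1) b' b'^T M') v.
  by move=> v0; apply: lt_le_trans (Apos v v0) (AB v).
have e1 : row_mx (1%:M : 'M[R]_1) (0 : 'rV[R]_n) != 0.
  by rewrite row0 oner_eq0.
have q1 (c : R) (d : 'rV[R]_n) N : qform (block_mx (c%:M : 'M[R]_1) d d^T N) (row_mx 1%:M 0) = c.
  by rewrite qform_block /qform trmx0 !mulmx0 !mxE; ring.
have a0 : 0 < a by rewrite -(q1 a b M); exact: Apos.
have a'0 : 0 < a' by rewrite -(q1 a' b' M'); exact: Bpos.
have aa' : a <= a' by rewrite -(q1 a b M) -(q1 a' b' M'); exact: AB.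
rewrite !det_schur ?gt_eqF //.
have sym (c : R) (d : 'rV[R]_n) (N : 'M[R]_n) : N^T = N -> (N - c *: (d^T *m d))^T = N - c *: (d^T *m d).
  by move=> Ns; rewrite linearB /= linearZ /= trmx_mul trmxK Ns.
have [||y y0|y|d0 dd] := andP (IH (M - a^-1 *: (b^T *m b)) (M' - a'^-1 *: (b'^T *m b')) _ _ _ _).
- exact: sym.
- exact: sym.
(* This first coordinate kills the square, so the value of the form is that of the Schur
   complement. *)
- have := Apos (row_mx (- ((b *m y^T) 0 0 / a))%:M y).
  rewrite row0 (negbTE y0) andbF => /(_ isT).
  by rewrite qform_schur ?gt_eqF // addNr expr0n mulr0 add0r.
(* The minimiser for B is inserted in both forms: the square vanishes for B and is nonnegative for
   A. *)
- have := AB (row_mx (- ((b' *m y^T) 0 0 / a'))%:M y).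
  rewrite !qform_schur ?gt_eqF // addNr expr0n mulr0 add0r; apply: le_trans.
  by rewrite lerDr mulr_ge0 ?sqr_ge0 // ltW.
- by rewrite mulr_gt0 //= ler_pM // ltW.
Qed.
End quadratic_forms.

(** * Lipschitz extension and bi-Lipschitz perturbations of the identity *)

(** Completeness of the matrix space, on which the Banach fixed point theorem below rests. *)
HB.instance Definition _ (R : realType) m n :=
  Uniform_isComplete.Build 'M[R]_(m, n) (@cauchy_cvg 'M[R]_(m, n)).

Section lipschitz_extension.
Context {R : realType}.

(* McShane's formula [g x = inf_(p in A) f p + L |x - p|]. *)
Lemma mcshane_extension (V : normedModType R) (A : set V) (f : V -> R) (L : R) :
  0 <= L -> (forall x y, A x -> A y -> `|f x - f y| <= L * `|x - y|) ->
  exists2 g : V -> R, forall x, A x -> g x = f x &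
    forall x y, `|g x - g y| <= L * `|x - y|.
Proof.
move=> L0 fL.
have [->|/set0P[p0 Ap0]] := eqVneq A set0.
  exists (cst 0) => // x y; by rewrite subrr normr0 mulr_ge0.
pose E x := [set f p + L * `|x - p| | p in A].
have E0 x : E x !=set0 by exists (f p0 + L * `|x - p0|); exists p0.
have Elb x : lbound (E x) (f p0 - L * `|x - p0|).
  move=> _ [p Ap <-]; have := fL _ _ Ap0 Ap; rewrite ler_norml => /andP[_ h].
  have : L * `|p0 - p| <= L * (`|x - p0| + `|x - p|).
    by rewrite ler_wpM2l // (distrC x p0) ler_distD.
  by rewrite mulrDr; lra.
have hE x : has_lbound (E x) by exists (f p0 - L * `|x - p0|).
pose g x := inf (E x).
have gle x p : A p -> g x <= f p + L * `|x - p|.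
  by move=> Ap; apply: ge_inf => //; exists p.
have gxy x y : g x <= g y + L * `|x - y|.
  rewrite -lerBlDr; apply: lb_le_inf => // _ [p Ap <-].
  have : L * `|x - p| <= L * (`|x - y| + `|y - p|).
    by rewrite ler_wpM2l // ler_distD.
  by rewrite mulrDr; have := gle x p Ap; lra.
exists g => [x Ax|x y]; last first.
  rewrite ler_norml; have := gxy x y; have := gxy y x; rewrite (distrC y x).
  by move=> ? ?; apply/andP; split; lra.
apply/eqP; rewrite eq_le; apply/andP; split.
  by have := gle x x Ax; rewrite subrr normr0 mulr0 addr0.
apply: lb_le_inf => // _ [p Ap <-]; have := fL _ _ Ax Ap.
by rewrite ler_norml => /andP[_]; lra.
Qed.

(** Extending coordinate by coordinate keeps the constant L because the norm on the target is the
    sup norm. *)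
Lemma mcshane_extension_rV (V : normedModType R) m (A : set V) (f : V -> 'rV[R]_m)
    (L : R) :
  0 <= L -> (forall x y, A x -> A y -> `|f x - f y| <= L * `|x - y|) ->
  exists2 g : V -> 'rV[R]_m, forall x, A x -> g x = f x &
    forall x y, `|g x - g y| <= L * `|x - y|.
Proof.
move=> L0 fL.
have ext j : exists g : V -> R, (forall x, A x -> g x = f x 0 j) /\
    forall x y, `|g x - g y| <= L * `|x - y|.
  have [|g g1 g2] := @mcshane_extension V A (fun x => f x 0 j) L L0.
    move=> x y Ax Ay; apply: le_trans (fL x y Ax Ay).
    by have := ler_rV_norm (f x - f y) j; rewrite !mxE.
  by exists g.
have [g gP] := choice ext.
exists (fun x => \row_j g j x) => [x Ax|x y].
  by apply/rowP => j; rewrite mxE; have [-> //] := gP j.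
by apply: rV_norm_le => [|j]; rewrite ?mulr_ge0 // !mxE; have [_] := gP j; exact.
Qed.

Definition bilipschitz l (C D : R) (Phi Psi : 'rV[R]_l -> 'rV[R]_l) : Prop :=
  [/\ cancel Phi Psi, cancel Psi Phi,
      forall x y, enorm (Phi x - Phi y) <= C * enorm (x - y) &
      forall x y, enorm (Psi x - Psi y) <= D * enorm (x - y)].

Lemma bilipschitz_sym l C D (Phi Psi : 'rV[R]_l -> 'rV[R]_l) :
  bilipschitz C D Phi Psi -> bilipschitz D C Psi Phi.
Proof. by move=> []. Qed.

(** A preimage of y is a fixed point of the contraction [y - G x] in x. *)
Lemma perturbation_surjective l (G : 'rV[R]_l -> 'rV[R]_l) (q : R) :
  0 <= q < 1 -> (forall x y, `|G x - G y| <= q * `|x - y|) ->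
  forall y, exists x, x + G x = y.
Proof.
move=> /andP[q0 q1] GL y.
pose h x := y - G x.
pose hM := isFun.Build _ _ setT setT h (fun _ _ => I).
pose H : {fun [set: 'rV[R]_l] >-> [set: 'rV[R]_l]} := HB.pack h hM.
have ctr : is_contraction H.
  exists (NngNum q0); split => //= -[x z] _ /=.
  by rewrite /h opprB addrC subrKA distrC.
have [||x _ xE] := banach_fixed_point ctr.
- exact: closedT.
- by exists 0.
- by exists x; rewrite {1}xE /= /h subrK.
Qed.

(** It is [f - id] that gets extended, so the small constant survives. The factor [l.+1] pays for
    the passage from the sup norm to the Euclidean norm; being at least 1 it also yields [L < 1],
    the contraction bound, when l = 0. *)
Lemma perturbation_bilipschitz l (A : set 'rV[R]_l) (f : 'rV[R]_l -> 'rV[R]_l) (L : R) :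
  0 <= L -> l.+1%:R * L < 1 ->
  (forall x y, A x -> A y -> `|(f x - f y) - (x - y)| <= L * `|x - y|) ->
  exists Phi Psi, (forall x, A x -> Phi x = f x) /\
    bilipschitz (1 + l.+1%:R * L) (1 - l.+1%:R * L)^-1 Phi Psi.
Proof.
move=> L0 lL fL.
have [x y Ax Ay|G GA GL] := @mcshane_extension_rV 'rV[R]_l l A (fun x => f x - x) L L0.
  apply: le_trans (fL x y Ax Ay).
  by rewrite !opprB addrACA [X in _ <= `|X|]addrACA [- x + _]addrC.
have L1 : 0 <= L < 1.
  rewrite L0 /=; apply: le_lt_trans lL; rewrite ler_peMl // ler1n //.
have [Psi PsiP] := choice (perturbation_surjective L1 GL).
have Ge x y : enorm (G x - G y) <= l.+1%:R * L * enorm (x - y).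
  apply: le_trans (enorm_le_norm _) _.
  rewrite -mulrA; apply: ler_pM => //; first by rewrite ler_nat.
  by apply: le_trans (GL x y) _; rewrite ler_wpM2l // norm_le_enorm.
set q := l.+1%:R * L in lL Ge *.
pose Phi x := x + G x.
have PhiB x y : Phi x - Phi y = (x - y) + (G x - G y).
  by rewrite /Phi opprD addrACA.
have lower x y : (1 - q) * enorm (x - y) <= enorm (Phi x - Phi y).
  rewrite PhiB -[G x - G y]opprK; apply: le_trans (ler_enormB _ _).
  by rewrite enormN; have := Ge x y; lra.
have q1 : 0 < 1 - q by rewrite subr_gt0.
have Phi_inj : injective Phi.
  move=> x y xy; have := lower x y; rewrite xy subrr enorm0.
  rewrite pmulr_rle0 // => le0; apply/eqP; rewrite -subr_eq0; apply/eqP/enorm_eq0.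
  by apply/eqP; rewrite eq_le le0 enorm_ge0.
exists Phi, Psi; split; first by move=> x Ax; rewrite /Phi GA // addrC subrK.
split=> [x|//|x y|x y].
- by apply: Phi_inj; exact: PsiP.
- rewrite PhiB; apply: le_trans (ler_enormD _ _) _.
  by have := Ge x y; lra.
- by rewrite ler_pdivlMl //; apply: le_trans (lower _ _) _; rewrite /Phi !PsiP.
Qed.

End lipschitz_extension.

(** * Borel sets of R^n and densities *)

Section borel.
Context {R : realType}.

Lemma measurable_fun_open d (T : measurableType d) n (D : set T) (f : T -> borel_rV R n) :
  (forall O : set 'rV[R]_n, open O -> measurable (D `&` f @^-1` O)) ->
  measurable_fun D f.
Proof.
move=> fO; apply: (@measurability _ _ _ _ D f (@open 'rV[R]_n)) => // _ [V oV <-].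
exact: fO.
Qed.

Lemma open_borel n (O : set 'rV[R]_n) : open O -> measurable (O : set (borel_rV R n)).
Proof. by move=> oO; apply: sub_sigma_algebra. Qed.

Lemma closed_borel n (O : set 'rV[R]_n) : closed O -> measurable (O : set (borel_rV R n)).
Proof. by move/closed_openC/open_borel/measurableC; rewrite setCK. Qed.

Lemma continuous_borel n m (f : 'rV[R]_n -> 'rV[R]_m) : continuous f ->
  measurable_fun [set: borel_rV R n] (f : borel_rV R n -> borel_rV R m).
Proof.
move=> /continuousP cf; apply: measurable_fun_open => O oO; rewrite setTI.
by apply: open_borel; exact: cf.
Qed.

Lemma open_continuous_measurable n (U : set 'rV[R]_n) (f : 'rV[R]_n -> R) :
  open U -> (forall x, U x -> {for x, continuous f}) ->
  measurable_fun (U : set (borel_rV R n)) f.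
Proof.
move=> oU cf; apply: (measurability _ (measurable_realfun.RGenOpens.measurableE R)).
move=> _ [_ [a [b ->] <-]]; apply: open_borel.
rewrite openE => x [Ux fx]; apply: filterI; first exact: (open_nbhs_nbhs (conj oU Ux)).
by apply: (cf x Ux); apply: open_nbhs_nbhs; split=> //; exact: interval_open.
Qed.

Lemma continuous_measurable_rV n (f : 'rV[R]_n -> R) : continuous f ->
  measurable_fun [set: borel_rV R n] f.
Proof.
by move=> cf; apply: open_continuous_measurable => [|x _]; [exact: openT|exact: cf].
Qed.

Lemma measurable_coord n i : measurable_fun [set: borel_rV R n] (fun v => v 0 i : R).
Proof. by apply: continuous_measurable_rV => x; exact: coord_continuous. Qed.

(* An open set is a countable union of cubes with rational centres. *)
Lemma measurable_fun_rV d (T : measurableType d) n (f : T -> borel_rV R n) :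
  (forall i, measurable_fun [set: T] (fun t => f t 0 i : R)) ->
  measurable_fun [set: T] f.
Proof.
move=> mf; apply: measurable_fun_open => O oO; rewrite setTI.
pose c (k : 'rV[rat]_n * nat) : 'rV[R]_n := map_mx ratr k.1.
pose B (k : 'rV[rat]_n * nat) := [set v : 'rV[R]_n | forall i, `|c k 0 i - v 0 i| < k.2.+1%:R^-1].
pose F (k : 'rV[rat]_n * nat) : set T := if pselect (B k `<=` O) then f @^-1` B k else set0.
have -> : f @^-1` O = \bigcup_k F k.
  rewrite eqEsubset; split=> [t /= Ot|t [k _]]; last first.
    by rewrite /F; case: pselect => //= BO /BO.
  have /nbhs_ballP[e /= e0 eO] : nbhs (f t : 'rV[R]_n) O by exact: open_nbhs_nbhs.
  have [N _ Ne] := near_infty_natSinv_lt (PosNum (divr_gt0 e0 (ltr0n R 2))).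
  have N1 : N.+1%:R^-1 < e / 2 by have := Ne N (leqnn N).
  have /choice[q qP] i : exists q : rat, `|ratr q - f t 0 i| < N.+1%:R^-1.
    have itv : f t 0 i - N.+1%:R^-1 < f t 0 i + N.+1%:R^-1.
      by rewrite ltrD2l -subr_gt0 opprK addr_gt0.
    have [q] := rat_in_itvoo itv.
    rewrite in_itv /= => /andP[q1 q2]; exists q; rewrite ltr_norml.
    by rewrite ltrBrDr addrC q1 ltrBlDl q2.
  exists (\row_i q i, N) => //; rewrite /F; case: pselect => [BO|/= nBO]; last first.
    exfalso; apply: nBO => v Bv; apply: eO; apply/ball_rV => // i.
    have := qP i; have := Bv i; rewrite /c !mxE /= => h1 h2.
    have -> : f t 0 i - v 0 i = (ratr (q i) - v 0 i) - (ratr (q i) - f t 0 i).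
      by rewrite opprB [RHS]addrC subrKA.
    apply: le_lt_trans (ler_normB _ _) _.
    by apply: lt_le_trans (ltrD h1 h2) _; rewrite (splitr e) lerD // ltW.
  by move=> i /=; rewrite /c !mxE /=; exact: qP.
apply: countable_bigcupT_measurable => // k.
rewrite /F; case: (pselect (B k `<=` O)) => ? /=; last exact: measurable0.
rewrite (_ : f @^-1` B k = \bigcap_(i in [set: 'I_n])
   (fun t => f t 0 i) @^-1` (ball (c k 0 i) k.2.+1%:R^-1)); last first.
  by rewrite eqEsubset; split=> t /= Bt i; [move=> _; exact: Bt|exact: (Bt i I)].
apply: fin_bigcap_measurable => // i _; rewrite -[X in measurable X]setTI.
by apply: mf => //; apply: open_measurable; exact: ball_open.
Qed.

End borel.

Section density.
Context d (T : measurableType d) (R : realType).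
Local Open Scope ereal_scope.
Import HBNNSimple.

(** The identity is the hypothesis for indicators, extends by linearity to the simple functions
    approximating f, and passes to the limit by monotone convergence on both sides. *)
Lemma integral_density (mu nu : {measure set T -> \bar R}) (h : T -> R) (E : set T)
    (f : T -> \bar R) :
  measurable E -> measurable_fun E h -> (forall x, E x -> (0 <= h x)%R) ->
  (forall A, measurable A -> A `<=` E -> nu A = \int[mu]_(x in A) (h x)%:E) ->
  measurable_fun E f -> (forall x, E x -> 0 <= f x) ->
  \int[nu]_(x in E) f x = \int[mu]_(x in E) (f x * (h x)%:E).
Proof.
move=> mE mh h0 nuE mf f0.
have mhE : measurable_fun E (EFin \o h) by exact/measurable_EFinP.
pose g := nnsfun_approx mE mf.
have gE n x : (g n x)%:E = \sum_(y \in range (g n)) (y * \1_(g n @^-1` [set y]) x)%:E.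
  by rewrite /= fimfunE -fsumEFin.
have gcvg x : E x -> (g n x)%:E @[n --> \oo] --> f x.
  by move=> Ex; apply: cvg_nnsfun_approx.
have -> : \int[nu]_(x in E) f x = limn (fun n => \int[nu]_(x in E) (g n x)%:E).
{ rewrite -monotone_convergence //.
  - by apply: eq_integral => x /[!inE] Ex; apply/esym/cvg_lim => //; exact: gcvg.
  - by move=> n; apply/measurable_EFinP/measurable_funTS.
  - by move=> n x _; rewrite lee_fin.
  - by move=> x _ a b ab; rewrite lee_fin; exact/lefP/nd_nnsfun_approx. }
have -> : \int[mu]_(x in E) (f x * (h x)%:E) =
    limn (fun n => \int[mu]_(x in E) ((g n x)%:E * (h x)%:E)).
{ rewrite -monotone_convergence //.
  - apply: eq_integral => x /[!inE] Ex; apply/esym/cvg_lim => //.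
    by apply: cvgeZr => //; exact: gcvg.
  - move=> n; apply: emeasurable_funM => //.
    by apply/measurable_EFinP/measurable_funTS.
  - by move=> n x Ex; rewrite mule_ge0 // lee_fin // h0.
  - move=> x Ex a b ab; rewrite lee_wpmul2r ?lee_fin ?h0 //.
    exact/lefP/nd_nnsfun_approx. }
congr (limn _); apply/funext => n.
under eq_integral do rewrite gE.
rewrite [RHS](_ : _ = \int[mu]_(x in E) \sum_(y \in range (g n))
    ((y * \1_(g n @^-1` [set y]) x)%:E * (h x)%:E)); last first.
  apply: eq_integral => x _; rewrite gE ge0_mule_fsuml // => y.
  exact: nnfun_muleindic_ge0.
have mpre r : measurable (g n @^-1` [set r]) by exact: measurable_sfunP.
have mind r : measurable_fun E (fun x => (r * \1_(g n @^-1` [set r]) x)%:E).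
  by apply/measurable_EFinP/measurable_funM => //; exact: measurable_indic.
rewrite ge0_integral_fsum //; last by move=> r x _; exact: nnfun_muleindic_ge0.
rewrite ge0_integral_fsum //; last 2 first.
  by move=> r; apply: emeasurable_funM.
  by move=> r x Ex; apply: mule_ge0; [exact: nnfun_muleindic_ge0|rewrite lee_fin h0].
apply: eq_fsbigr => r _.
rewrite integralZl_indic_nnsfun // integral_indic //.
(* A nonnegative simple function has empty level sets at negative values, so both sides vanish
   there. *)
have [r0|r0] := leP 0%R r; last first.
  have pre0 : g n @^-1` [set r] = set0.
    by apply: preimage_nnfun0.
  rewrite pre0 set0I measure0 mule0 integral0_eq // => x _.
  by rewrite indic0 /= mulr0 mul0e.
under [RHS]eq_integral do rewrite EFinM -muleA.
rewrite ge0_integralZl //; last 2 first.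
  apply: emeasurable_funM => //; exact/measurable_EFinP/measurable_indic.
  by move=> x Ex; rewrite mule_ge0 ?lee_fin // h0.
congr (_ * _); rewrite nuE; last 2 first.
  exact: measurableI.
  exact: subIsetr.
under [RHS]eq_integral do rewrite muleC.
rewrite [RHS](eq_integral ((fun x => (h x)%:E) \_ (g n @^-1` [set r]))); last first.
  by move=> x _; rewrite epatch_indic.
by rewrite -integral_mkcondr setIC.
Qed.
End density.

(** * Lebesgue measure on R^n and Gaussian integrals *)

Section density_measure.
Context d (T : measurableType d) (R : realType).
Local Open Scope ereal_scope.

Lemma exists_pushforward_measure d' (T' : measurableType d')
    (mu : {measure set T -> \bar R}) (f : T -> T') : measurable_fun setT f ->
  exists nu : {measure set T' -> \bar R}, forall A, nu A = mu (f @^-1` A).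
Proof.
move=> mf.
by exists (measure_function_pushforward__canonical__measure_function_Measure mu mf).
Qed.

Lemma exists_density_measure (mu : {measure set T -> \bar R}) (E : set T) (h : T -> R) :
  measurable E -> measurable_fun E h -> (forall x, E x -> (0 <= h x)%R) ->
  exists nu : {measure set T -> \bar R},
    forall A, measurable A -> nu A = \int[mu]_(x in A `&` E) (h x)%:E.
Proof.
move=> mE mh h0.
have mhE A : measurable A -> measurable_fun (A `&` E) (EFin \o h).
  move=> mA; apply/measurable_EFinP.
  by apply: measurable_funS mh => //; exact: subIsetr.
pose nu (A : set T) := \int[mu]_(x in A `&` E) (h x)%:E.
have nu0 : nu set0 = 0 by rewrite /nu set0I integral_set0.
have nu_ge0 A : 0 <= nu A.
  by apply: integral_ge0 => x [_ Ex]; rewrite lee_fin h0.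
have nuU : semi_sigma_additive nu.
  move=> F mF tF mUF; rewrite /nu setI_bigcupl ge0_integral_bigcup //.
  - by apply: is_cvg_nneseries => n _ _; exact: nu_ge0.
  - by move=> k; exact: measurableI.
  - by rewrite -setI_bigcupl; exact: mhE.
  - by move=> x [i _ [_ Ex]]; rewrite lee_fin h0.
  - exact: trivIset_setIr.
pose nuM := isMeasure.Build _ _ _ nu nu0 nu_ge0 nuU.
pose nu' : {measure set T -> \bar R} := HB.pack nu nuM.
by exists nu'.
Qed.

End density_measure.

Section lebesgue_rV.
Context {R : realType}.

(** The splitting of the first coordinate used in the recursion of [integral_rV]. *)
Definition cons_rV n (z : R * 'rV[R]_n) : 'rV[R]_n.+1 := row_mx (z.1%:M : 'rV[R]_1) z.2.

Lemma cons_rV0 n z : @cons_rV n z 0 0 = z.1.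
Proof. by rewrite mxE; case: splitP => // j _; rewrite ord1 mxE. Qed.

Lemma cons_rVS n z i : @cons_rV n z 0 (lift ord0 i) = z.2 0 i.
Proof.
rewrite mxE; case: splitP => [j|j [/ord_inj <-] //].
by rewrite ord1.
Qed.

Lemma measurable_cons_rV n :
  measurable_fun [set: measurableTypeR R * borel_rV R n]
    (@cons_rV n : _ -> borel_rV R n.+1).
Proof.
apply: measurable_fun_rV => i; case: (unliftP ord0 i) => [j|] ->.
  rewrite (_ : (fun t => _) = (fun v : borel_rV R n => v 0 j : R) \o snd).
    apply: measurableT_comp; [exact: measurable_coord|exact: measurable_snd].
  by apply/funext => t; rewrite cons_rVS.
rewrite (_ : (fun t => _) = fst); first exact: measurable_fst.
by apply/funext => t; rewrite cons_rV0.
Qed.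

Definition uncons_rV n (v : 'rV[R]_n.+1) : R * 'rV[R]_n := (v 0 0, \row_i v 0 (lift ord0 i)).

Lemma cons_rVK n : cancel (@cons_rV n) (@uncons_rV n).
Proof.
move=> [x y]; rewrite /uncons_rV cons_rV0; congr pair.
by apply/rowP => i; rewrite mxE cons_rVS.
Qed.

Lemma measurable_uncons_rV n :
  measurable_fun [set: borel_rV R n.+1]
    (@uncons_rV n : _ -> measurableTypeR R * borel_rV R n).
Proof.
apply: measurable_fun_pair; first exact: measurable_coord.
apply: measurable_fun_rV => i.
rewrite (_ : (fun t => _) = fun t : borel_rV R n.+1 => t 0 (lift ord0 i) : R).
  exact: measurable_coord.
by apply/funext => t; rewrite mxE.
Qed.

(** The measure on R^(n + 1) is the push-forward under [cons_rV] of the product of Lebesgue measure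
    on the line with the measure on R^n, and Tonelli's theorem unfolds one iterated integral.
    Sigma-finiteness is carried along for the next use of Tonelli. *)
Lemma exists_lebesgue_rV n :
  exists leb : {sigma_finite_measure set (borel_rV R n) -> \bar R},
    forall f : borel_rV R n -> \bar R, measurable_fun [set: borel_rV R n] f ->
      (forall x, 0 <= f x)%E -> integral_rV f = (\int[leb]_x f x)%E.
Proof.
elim: n => [|n [leb IH]].
  exists (dirac (0 : borel_rV R 0)) => f mf f0.
  by rewrite integral_dirac // diracT mul1e.
have mc := @measurable_cons_rV n.
pose mu : {measure set (measurableTypeR R * borel_rV R n)%type -> \bar R} :=
  (@lebesgue_measure R \x leb)%E.
have [nu nuE] := exists_pushforward_measure mu mc.
have /sigma_finiteP[F [FT ndF Ffin]] := sigma_finiteT (@lebesgue_measure R).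
have /sigma_finiteP[G [GT ndG Gfin]] := sigma_finiteT leb.
have sf : sigma_finite setT nu.
  (* The exhaustions [F] and [G] are nondecreasing, so the diagonal products already cover the plane
     of pairs. *)
  exists (fun i => @uncons_rV n @^-1` (F i `*` G i)) => [|k].
    rewrite -preimage_bigcup (_ : \bigcup_i _ = setT) ?preimage_setT //.
    rewrite eqEsubset; split=> // -[x y] _.
    have [i _ Fx] : (\bigcup_i F i) x by rewrite -FT.
    have [j _ Gy] : (\bigcup_i G i) y by rewrite -GT.
    exists (maxn i j) => //; split=> /=.
      by move: x Fx; exact/subsetPset/ndF/leq_maxl.
    by move: y Gy; exact/subsetPset/ndG/leq_maxr.
  have [mF Foo] := Ffin k; have [mG Goo] := Gfin k; split.
    rewrite -[X in measurable X]setTI; apply: measurable_uncons_rV => //.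
    exact: measurableX.
  rewrite nuE (_ : _ @^-1` _ = F k `*` G k).
    by rewrite /mu /= product_measure1E // lte_mul_pinfty // ge0_fin_numE.
  rewrite -comp_preimage (_ : _ \o _ = id) ?preimage_id //.
  by apply/funext => z; exact: cons_rVK.
pose nuS := isSFinite.Build _ _ _ (nu : set _ -> \bar R) (sfinite_measure_sigma_finite sf).
pose nuF := isSigmaFinite.Build _ _ _ (nu : set _ -> \bar R) sf.
pose nu' : {sigma_finite_measure set (borel_rV R n.+1) -> \bar R} :=
  HB.pack (Measure.sort nu) nuS nuF.
exists nu' => f mf f0.
pose C : (measurableTypeR R * borel_rV R n)%type -> borel_rV R n.+1 := @cons_rV n.
have mfc : measurable_fun setT (f \o C) by exact: measurableT_comp.
rewrite (eq_measure_integral (pushforward mu C)); last by move=> A mA _; exact: nuE.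
rewrite ge0_integral_pushforward // preimage_setT.
rewrite fubini_tonelli1 //; last by move=> z; exact: f0.
rewrite [LHS](_ : _ = \int[lebesgue_measure]_x
  integral_rV (fun y : 'rV[R]_n => f (C (x, y))))%E //.
apply: eq_integral => x _; rewrite IH //.
apply: (measurableT_comp mfc); exact: measurable_fun_pair.
Qed.

(* [1 / (4 pi t) ^ (1/2)] times the heat kernel is the normal density of
   variance [2 t]. *)
Lemma integral_gauss1 (m t : R) : 0 < t ->
  (\int[lebesgue_measure]_x (expR (- (x - m) ^+ 2 / (4 * t)))%:E =
   (Num.sqrt (4 * pi * t))%:E)%E.
Proof.
move=> t0; pose s := Num.sqrt (2 * t).
have s0 : s != 0 by rewrite gt_eqF // sqrtr_gt0 mulr_gt0.
have s2 : s ^+ 2 = 2 * t by rewrite sqr_sqrtr // mulr_ge0 // ltW.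
have peak : normal_peak s = (Num.sqrt (4 * pi * t))^-1.
  rewrite /normal_peak s2; congr (Num.sqrt _)^-1; ring.
have c0 : 0 < Num.sqrt (4 * pi * t).
  by rewrite sqrtr_gt0 !mulr_gt0 // pi_gt0.
rewrite (_ : (fun x => _) = fun x => ((Num.sqrt (4 * pi * t))%:E * (normal_pdf m s x)%:E)%E).
  rewrite ge0_integralZl ?integral_normal_pdf ?mule1 //.
  - by apply/measurable_EFinP; exact: measurable_normal_pdf.
  - by move=> x _; rewrite lee_fin normal_pdf_ge0.
apply/funext => x; rewrite normal_pdfE // peak -EFinM mulrA divff ?gt_eqF // mul1r.
by rewrite /normal_fun s2; congr (expR (_ / _))%:E; ring.
Qed.

Lemma enorm_cons_rV n z : enorm (@cons_rV n z) ^+ 2 = z.1 ^+ 2 + enorm z.2 ^+ 2.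
Proof.
rewrite !enorm_sqr big_ord_recl cons_rV0; congr (_ + _).
by apply: eq_bigr => i _; rewrite cons_rVS.
Qed.

(** The Gaussian is a product over the coordinates; the constant c absorbs the factor of the outer
    variable when the induction hypothesis is applied to the inner integral. *)
Lemma integral_rV_gauss n (m : 'rV[R]_n) (t c : R) : 0 < t -> 0 <= c ->
  integral_rV (fun x => (c * expR (- enorm (x - m) ^+ 2 / (4 * t)))%:E) =
  (c * Num.sqrt (4 * pi * t) ^+ n)%:E.
Proof.
move=> t0; elim: n m c => [|n IH] m c c0 /=.
  rewrite (_ : 0 - m = 0) ?enorm0; last by apply/rowP => -[].
  by rewrite expr0n oppr0 mul0r expR0 expr0.
have [m0 [m' mE]] : exists a b, m = @cons_rV n (a, b).
  exists (uncons_rV m).1, (uncons_rV m).2; apply/rowP => i.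
  by case: (unliftP ord0 i) => [j|] ->; rewrite ?cons_rVS ?cons_rV0 //= mxE.
transitivity (\int[lebesgue_measure]_x
  ((c * expR (- (x - m0) ^+ 2 / (4 * t)) * Num.sqrt (4 * pi * t) ^+ n)%:E))%E.
  apply: eq_integral => x _; rewrite -(IH m') ?mulr_ge0 ?expR_ge0 //.
  congr integral_rV; apply/funext => y; congr (_%:E).
  have -> : enorm (row_mx (x%:M : 'rV[R]_1) y - m : 'rV[R]_n.+1) ^+ 2 =
      (x - m0) ^+ 2 + enorm (y - m') ^+ 2.
    rewrite -[RHS](enorm_cons_rV (x - m0, y - m')); congr (enorm _ ^+ 2).
    apply/rowP => i; rewrite mE; case: (unliftP ord0 i) => [j|] ->.
      by rewrite [RHS]cons_rVS [LHS]mxE [X in _ + X]mxE cons_rVS (cons_rVS (x, y)) !mxE.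
    by rewrite [RHS]cons_rV0 [LHS]mxE [X in _ + X]mxE cons_rV0 (cons_rV0 (x, y)).
  by rewrite opprD mulrDl expRD mulrA.
under eq_integral do rewrite mulrAC EFinM.
rewrite ge0_integralZl //.
- by rewrite integral_gauss1 // exprSr mulrA EFinM.
- apply/measurable_EFinP; apply: measurableT_comp => //.
  apply: measurable_funM => //; apply: measurableT_comp => //.
  by apply: measurable_funX; apply: measurable_funB.
- by rewrite lee_fin; apply: mulr_ge0 => //; apply: exprn_ge0; exact: sqrtr_ge0.
Qed.

End lebesgue_rV.

(** * Charts *)

Section continuity.
Context {R : realType}.

Lemma lipschitz_continuous (V W : normedModType R) (f : V -> W) (L : R) :
  (forall x y, `|f x - f y| <= L * `|x - y|) -> continuous f.
Proof.
move=> fL x; apply/cvgrPdist_lt => e e0.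
have L1 : 0 < `|L| + 1 by rewrite ltr_wpDl.
near=> y; apply: le_lt_trans (fL x y) _.
apply: (@le_lt_trans _ _ ((`|L| + 1) * `|x - y|)).
  by rewrite ler_wpM2r // (le_trans (ler_norm L)) // lerDl.
rewrite -ltr_pdivlMl //.
suff : ball x ((`|L| + 1)^-1 * e) y by rewrite -ball_normE.
by near: y; apply: nbhsx_ballx; rewrite mulr_gt0 // invr_gt0.
Unshelve. all: by end_near. Qed.

Lemma enorm_lipschitz n (x y : 'rV[R]_n) : `|enorm x - enorm y| <= n%:R * `|x - y|.
Proof.
apply: le_trans (enorm_le_norm (x - y)); rewrite ler_norml.
have := ler_enormB x y; have := ler_enormB y x; rewrite (enormB y x).
by move=> h1 h2; apply/andP; split; lra.
Qed.

Lemma enorm_continuous n : continuous (@enorm R n).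
Proof. exact: lipschitz_continuous (@enorm_lipschitz n). Qed.

Lemma bilipschitz_continuous l C D (Phi Psi : 'rV[R]_l -> 'rV[R]_l) :
  0 <= C -> bilipschitz C D Phi Psi -> continuous Phi.
Proof.
move=> C0 [_ _ PhiC _]; apply: (@lipschitz_continuous _ _ _ (C * l%:R)) => x y.
apply: le_trans (norm_le_enorm _) _; apply: le_trans (PhiC x y) _.
by rewrite -mulrA ler_wpM2l // enorm_le_norm.
Qed.

Section bigop.
Context (T : topologicalType) (x : T).

Lemma continuous_at_sum I (r : seq I) (F : I -> T -> R) :
  (forall i, {for x, continuous (F i)}) ->
  {for x, continuous (fun y => \sum_(i <- r) F i y)}.
Proof.
move=> cF; elim: r => [|i r IH].
  rewrite (_ : (fun _ => _) = cst 0); first exact: cst_continuous.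
  by apply/funext => y; rewrite big_nil.
rewrite (_ : (fun _ => _) = (fun y => F i y + \sum_(i <- r) F i y)).
  by apply: continuousD.
by apply/funext => y; rewrite big_cons.
Qed.

Lemma continuous_at_prod I (r : seq I) (F : I -> T -> R) :
  (forall i, {for x, continuous (F i)}) ->
  {for x, continuous (fun y => \prod_(i <- r) F i y)}.
Proof.
move=> cF; elim: r => [|i r IH].
  rewrite (_ : (fun _ => _) = cst 1); first exact: cst_continuous.
  by apply/funext => y; rewrite big_nil.
rewrite (_ : (fun _ => _) = (fun y => F i y * \prod_(i <- r) F i y)).
  by apply: continuousM.
by apply/funext => y; rewrite big_cons.
Qed.

Lemma continuous_at_det n (F : T -> 'M[R]_n) :
  (forall i j, {for x, continuous (fun y => F y i j)}) ->
  {for x, continuous (fun y => \det (F y))}.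
Proof.
move=> cF; apply: continuous_at_sum => s.
apply: continuousM; first exact: cst_continuous.
exact: continuous_at_prod.
Qed.

End bigop.
End continuity.

Section charts.
Context {R : realType} {k l : nat}.
Implicit Types (S : set 'rV[R]_l) (U : set 'rV[R]_k) (phi : 'rV[R]_k -> 'rV[R]_l).

Lemma row_jacobian n m (f : 'rV[R]_n -> 'rV[R]_m) x i :
  differentiable f x -> row i (jacobian f x) = 'D_(e_ i) f x.
Proof. by move=> df; rewrite rowE deriveEjacobian. Qed.

Lemma jacobian_comp n m p (f : 'rV[R]_n -> 'rV[R]_m) (g : 'rV[R]_m -> 'rV[R]_p) x :
  differentiable f x -> differentiable g (f x) ->
  jacobian (g \o f) x = jacobian f x *m jacobian g (f x).
Proof.
move=> df dg; apply/row_matrixP => i; rewrite !rowE mulmxA.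
rewrite -deriveEjacobian; last exact: differentiable_comp.
rewrite deriveE; last exact: differentiable_comp.
by rewrite diff_comp //= -!deriveE // !deriveEjacobian.
Qed.

Lemma near_eq_jacobian n m (f g : 'rV[R]_n -> 'rV[R]_m) x :
  differentiable f x -> differentiable g x -> (\near x, f x = g x) ->
  jacobian f x = jacobian g x.
Proof.
move=> df dg fg; apply/row_matrixP => i.
exact: etrans (row_jacobian i df) (etrans (near_eq_derive _ fg) (esym (row_jacobian i dg))).
Qed.

Lemma jacobian_id n (x : 'rV[R]_n) : jacobian id x = 1%:M.
Proof.
apply/row_matrixP => i; rewrite !rowE mulmx1 -deriveEjacobian ?derive_id //.
Qed.

Lemma local_param_open S U phi : local_param S U phi -> open U.
Proof. by case. Qed.

Lemma local_param_smooth S U phi : local_param S U phi -> smooth_on U phi.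
Proof. by move=> [_ [W _ []]]. Qed.

Lemma local_param_differentiable S U phi u :
  local_param S U phi -> U u -> differentiable phi u.
Proof.
move=> lp Uu.
exact: smooth_on_differentiable (local_param_open lp) (local_param_smooth lp) Uu.
Qed.

Lemma local_param_continuous S U phi u :
  local_param S U phi -> U u -> {for u, continuous phi}.
Proof.
by move=> lp Uu; apply: differentiable_continuous; exact: local_param_differentiable lp Uu.
Qed.

(** The inverse of a chart lives on a subset of S; its smooth extension g to an open set of R^l can
    be differentiated in the ordinary sense. Shrinking V into the open set W of the chart places
    every point of S in V inside the chart. *)
Lemma local_param_inverse S U phi u : local_param S U phi -> U u ->
  exists (V : set 'rV[R]_l) (g : 'rV[R]_l -> 'rV[R]_k),
    [/\ open V, V (phi u), forall r, of_class r V g,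
      forall x, S x -> V x -> U (g x) /\ phi (g x) = x &
      forall v, U v -> V (phi v) -> g (phi v) = v].
Proof.
move=> [oU [W oW [phiU sphi [g sg gK]]]] Uu.
have Sphi v : U v -> (S `&` W) (phi v) by move=> Uv; rewrite -phiU; exists v.
have [V [h [oV Vu Ch gh]]] := sg _ (Sphi u Uu).
exists (V `&` W), h; split.
- exact: openI.
- by split=> //; have [] := Sphi u Uu.
- move=> r; have /of_classP := Ch r => /(_ oV) Chr.
  apply/of_classP; [exact: openI|move=> j; apply: Cr_sub (Chr j)].
  exact: subIsetl.
- move=> x Sx [Vx Wx]; have : (S `&` W) x by [].
  by rewrite -{1}phiU => -[v Uv vx]; rewrite -vx in Vx *; rewrite -gh ?gK //; exact: Sphi.
- by move=> v Uv [Vv _]; rewrite -gh ?gK //; exact: Sphi.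
Qed.

Lemma of_class1_differentiable n m (V : set 'rV[R]_n) (g : 'rV[R]_n -> 'rV[R]_m) x :
  open V -> V x -> (forall r, of_class r V g) -> differentiable g x.
Proof.
move=> oV Vx Cg; apply: (Cr1_differentiable_rV oV Vx).
exact: ((of_classP 1 g oV).1 (Cg 1%N)).
Qed.

Lemma local_param_near S U phi u (V : set 'rV[R]_l) :
  local_param S U phi -> U u -> open V -> V (phi u) ->
  \forall v \near u, U v /\ V (phi v).
Proof.
move=> lp Uu oV Vu; have oU := local_param_open lp.
apply: filterI; first exact: (open_nbhs_nbhs (conj oU Uu)).
by apply: (local_param_continuous lp Uu); exact: (open_nbhs_nbhs (conj oV Vu)).
Qed.

Lemma local_param_S S U phi u : local_param S U phi -> U u -> S (phi u).
Proof.
move=> [_ [W _ [phiU _ _]]] Uu.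
by have [] : (S `&` W) (phi u) by rewrite -phiU; exists u.
Qed.

(** Differentiating [g \o phi = id] shows that the Jacobian of g at [phi u] is a right inverse of
    that of phi. *)
Lemma jacobian_inj S U phi u (v : 'rV[R]_k) :
  local_param S U phi -> U u -> v *m jacobian phi u = 0 -> v = 0.
Proof.
move=> lp Uu v0.
have [V [g [oV Vu Cg _ gK]]] := local_param_inverse lp Uu.
have dphi := local_param_differentiable lp Uu.
have dg := of_class1_differentiable oV Vu Cg.
have : jacobian (g \o phi) u = jacobian id u.
  apply: near_eq_jacobian => //; first exact: differentiable_comp.
  by apply: filterS (local_param_near lp Uu oV Vu) => w [Uw Vw]; exact: gK.
rewrite jacobian_comp // jacobian_id => E.
by rewrite -[v]mulmx1 -E mulmxA v0 mul0mx.
Qed.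

(** A is the Jacobian of the transition map. One A serves every h, and only the composites of h with
    the charts are differentiated; the instances of interest are h = [id] and the Lipschitz map
    [Phi]. *)
Lemma chart_transition S U1 phi1 U2 phi2 u1 u2 :
  local_param S U1 phi1 -> local_param S U2 phi2 -> U1 u1 -> U2 u2 ->
  phi1 u1 = phi2 u2 ->
  exists A : 'M[R]_k, forall m (h : 'rV[R]_l -> 'rV[R]_m),
    differentiable (h \o phi1) u1 -> differentiable (h \o phi2) u2 ->
    jacobian (h \o phi2) u2 = A *m jacobian (h \o phi1) u1.
Proof.
move=> lp1 lp2 Uu1 Uu2 e12.
have [V [g [oV Vu Cg gS gK]]] := local_param_inverse lp1 Uu1.
have dg := of_class1_differentiable oV Vu Cg.
have d2 := local_param_differentiable lp2 Uu2.
exists (jacobian (g \o phi2) u2) => m h dh1 dh2.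
have gu : g (phi2 u2) = u1 by rewrite -e12 gK.
have dgp : differentiable (g \o phi2) u2.
  by apply: differentiable_comp => //; rewrite -e12.
have dh1' : differentiable (h \o phi1) ((g \o phi2) u2) by rewrite /= gu.
have E : jacobian (h \o phi2) u2 = jacobian ((h \o phi1) \o (g \o phi2)) u2.
  apply: near_eq_jacobian => //; first exact: differentiable_comp.
  rewrite e12 in Vu.
  apply: filterS (local_param_near lp2 Uu2 oV Vu) => w [Uw Vw] /=.
  by have [|_ ->] := gS _ (local_param_S lp2 Uw).
apply: (etrans E); apply: (etrans (jacobian_comp dgp dh1')).
by congr (_ *m jacobian _ _).
Qed.

(** The case of equal forms in [det_posdef_le]: injectivity makes the Gram form positive
    definite. *)
Lemma gram_det_gt0 (J : 'M[R]_(k, l)) :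
  (forall v : 'rV[R]_k, v *m J = 0 -> v = 0) -> 0 < \det (J *m J^T).
Proof.
move=> Jinj; have Gs : (J *m J^T)^T = J *m J^T by rewrite trmx_mul trmxK.
have [] // := andP (det_posdef_le Gs Gs _ _) => v v0.
by rewrite qform_gram exprn_gt0 // enorm_gt0 //; apply: contraNneq v0 => /Jinj ->.
Qed.

Lemma area_density_ge0 phi u : 0 <= area_density phi u.
Proof. exact: sqrtr_ge0. Qed.

Lemma area_density_gt0 S U phi u : local_param S U phi -> U u -> 0 < area_density phi u.
Proof.
move=> lp Uu; rewrite sqrtr_gt0; apply: gram_det_gt0 => v.
exact: jacobian_inj lp Uu.
Qed.

Lemma area_density_mul (A : 'M[R]_k) (J : 'M[R]_(k, l)) :
  Num.sqrt (\det ((A *m J) *m (A *m J)^T)) = `|\det A| * Num.sqrt (\det (J *m J^T)).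
Proof.
rewrite trmx_mul !mulmxA -(mulmxA A) !det_mulmx det_tr mulrAC -expr2.
by rewrite sqrtrM ?sqr_ge0 // sqrtr_sqr.
Qed.

(** The factor [c ^ k] is the determinant of the homothety c on R^k. Moved into J, it reduces the
    claim to monotonicity of the determinant on Gram forms. *)
Lemma gram_det_le (c : R) (J J' : 'M[R]_(k, l)) : 0 <= c ->
  (forall v : 'rV[R]_k, v *m J' = 0 -> v = 0) ->
  (forall v : 'rV[R]_k, enorm (v *m J') <= c * enorm (v *m J)) ->
  Num.sqrt (\det (J' *m J'^T)) <= c ^+ k * Num.sqrt (\det (J *m J^T)).
Proof.
move=> c0 J'inj JJ'.
have E : c ^+ k * Num.sqrt (\det (J *m J^T)) =
    Num.sqrt (\det ((c *: J) *m (c *: J)^T)).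
  by rewrite -mul_scalar_mx area_density_mul det_scalar ger0_norm // exprn_ge0.
rewrite E; apply: ler_wsqrtr.
have Gs (M : 'M[R]_(k, l)) : (M *m M^T)^T = M *m M^T by rewrite trmx_mul trmxK.
have [] // := andP (det_posdef_le (Gs J') (Gs (c *: J)) _ _) => v.
  by move=> v0; rewrite qform_gram exprn_gt0 // enorm_gt0 //; apply: contraNneq v0 => /J'inj ->.
rewrite !qform_gram -scalemxAr enormZ ger0_norm //.
by rewrite ler_pXn2r ?nnegrE ?mulr_ge0 ?enorm_ge0.
Qed.

End charts.

(** * Area densities and their behaviour under bi-Lipschitz maps *)

Section density.
Context {R : realType} {k l : nat}.
Implicit Types (S : set 'rV[R]_l) (U : set 'rV[R]_k) (phi : 'rV[R]_k -> 'rV[R]_l).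

Lemma area_density_continuous S U phi u : local_param S U phi -> U u ->
  {for u, continuous (area_density phi)}.
Proof.
move=> lp Uu; have oU := local_param_open lp.
have Cphi j := smooth_on_open 1 j oU (local_param_smooth lp).
(* [jacobian] is built from the differential, while continuity is known for the partial derivatives;
   on U the two agree. *)
have entry i j x : U x -> jacobian phi x i j = 'D_(e_ i) (fun y => phi y 0 j) x.
  move=> Ux; have dphi := local_param_differentiable lp Ux.
  have := deriveEjacobian (e_ i) dphi; rewrite derive_mx; last exact: diff_derivable.
  by rewrite -rowE => /rowP/(_ j); rewrite !mxE.
have cJ i j : {for u, continuous (fun x => jacobian phi x i j)}.
  have [_ /(_ i)[_ [cD _]]] := Cphi j.
  apply: near_eq_continuous (cD u Uu).
  by apply: (open_near_eq oU) => // x Ux; rewrite entry.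
apply: (@continuous_comp _ _ _
  (fun x => \det (jacobian phi x *m (jacobian phi x)^T)) Num.sqrt); last exact: sqrt_continuous.
apply: continuous_at_det => i j.
rewrite (_ : (fun y => _) = (fun y => \sum_m jacobian phi y i m * jacobian phi y j m)).
  by apply: continuous_at_sum => m; apply: continuousM.
by apply/funext => y; rewrite mxE; apply: eq_bigr => m _; rewrite [_^T _ _]mxE.
Qed.

Section transport.
Context (S S' : set 'rV[R]_l) (C D : R) (Phi Psi : 'rV[R]_l -> 'rV[R]_l).
Hypotheses (C0 : 0 < C) (D0 : 0 < D) (PhiPsi : bilipschitz C D Phi Psi).
Hypothesis dPhi : diffeo S S' Phi.

Lemma bilipschitz_preimage : Phi @^-1` S' = S.
Proof.
have [PhiK PsiK _ _] := PhiPsi; have [<- _ _] := dPhi.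
rewrite eqEsubset; split=> [x [y Sy /(can_inj PhiK) <-]//|x Sx].
by exists x.
Qed.

Lemma diffeo_bilipschitz_inv : diffeo S' S Psi.
Proof. by have [PhiK _ _ _] := PhiPsi; apply: diffeo_inv dPhi _ => x _. Qed.

(** If W cuts the chart out of S, its preimage under [Psi] cuts the new chart out of S', and is open
    since [Psi] is continuous on all of R^l. *)
Lemma local_param_transport U phi : local_param S U phi ->
  local_param S' U (Phi \o phi).
Proof.
have [PhiK PsiK _ _] := PhiPsi.
move=> [oU [W oW dphi]]; split=> //; exists (Psi @^-1` W).
  have /continuousP := bilipschitz_continuous (ltW D0) (bilipschitz_sym PhiPsi).
  exact.
have -> : S' `&` Psi @^-1` W = Phi @` (S `&` W).
  rewrite -bilipschitz_preimage eqEsubset; split=> [y [Sy Wy]|_ [x [Sx Wx] <-]].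
    by exists (Psi y) => //; split=> //; rewrite /preimage /= PsiK.
  by split=> //; rewrite /preimage /= PhiK.
by apply: diffeo_comp dphi _; apply: diffeo_sub dPhi; exact: subIsetl.
Qed.

(** Each difference quotient of [Phi \o phi] has norm at most C times that of phi. The inequality
    passes to directional derivatives, which is the comparison of Jacobians required by
    [gram_det_le]. *)
Lemma area_density_transport_le U phi u : local_param S U phi -> U u ->
  area_density (Phi \o phi) u <= C ^+ k * area_density phi u.
Proof.
move=> lp Uu; have lp' := local_param_transport lp.
apply: gram_det_le; first exact: ltW.
  by move=> v; exact: jacobian_inj lp' Uu.
have d1 := local_param_differentiable lp Uu.
have d2 := local_param_differentiable lp' Uu.
move=> v.
(* [rewrite] would make unification unfold and compare the two jacobians. *)
suff H : enorm ('D_v (Phi \o phi) u) <= C * enorm ('D_v phi u).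
  exact: (eq_ind _ (fun w => enorm w <= C * enorm (v *m jacobian phi u))
    (eq_ind _ (fun w => enorm _ <= C * enorm w) H _ (deriveEjacobian v d1))
    _ (deriveEjacobian v d2)).
have c1 : derivable phi u v by exact: diff_derivable.
have c2 : derivable (Phi \o phi) u v by exact: diff_derivable.
rewrite /derive.
have l1 : (fun h : R => enorm (h^-1 *: (((Phi \o phi) \o shift u) (h *: v) - (Phi \o phi) u)))
    @ 0^' --> enorm (lim ((fun h : R => h^-1 *: (((Phi \o phi) \o shift u) (h *: v) - (Phi \o phi) u)) @ 0^')).
  by apply: continuous_cvg c2; exact: enorm_continuous.
have l2 : (fun h : R => C * enorm (h^-1 *: ((phi \o shift u) (h *: v) - phi u)))
    @ 0^' --> C * enorm (lim ((fun h : R => h^-1 *: ((phi \o shift u) (h *: v) - phi u)) @ 0^')).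
  apply: cvgM; first exact: cvg_cst.
  by apply: continuous_cvg c1; exact: enorm_continuous.
apply: (ler_cvg_to l1 l2); apply: nearW => h.
have [_ _ PhiC _] := PhiPsi.
rewrite !enormZ mulrCA ler_wpM2l //; exact: PhiC.
Qed.

(* A change of chart multiplies both densities by the same [|det A|]. *)
Lemma exists_area_jacobian p : submanifold k S -> S p ->
  exists2 J : R, 0 <= J & forall U phi u, local_param S U phi -> U u ->
    phi u = p -> area_density (Phi \o phi) u = J * area_density phi u.
Proof.
move=> mS Sp; have [U1 [phi1 [lp1 [u1 Uu1 e1]]]] := mS p Sp.
have d1 := area_density_gt0 lp1 Uu1.
exists (area_density (Phi \o phi1) u1 / area_density phi1 u1).
  by apply: divr_ge0; exact: area_density_ge0.
move=> U phi u lp Uu e.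
have e12 : phi1 u1 = phi u by rewrite e1 e.
have [A AE] := chart_transition lp1 lp Uu1 Uu e12.
have E1 : jacobian phi u = A *m jacobian phi1 u1.
  apply: (AE l id).
    exact: local_param_differentiable lp1 Uu1.
  exact: local_param_differentiable lp Uu.
have E2 : jacobian (Phi \o phi) u = A *m jacobian (Phi \o phi1) u1.
  apply: AE.
    exact: local_param_differentiable (local_param_transport lp1) Uu1.
  exact: local_param_differentiable (local_param_transport lp) Uu.
have ratio (t a a' x x' : R) : 0 < a -> x = t * a -> x' = t * a' -> x' = a' / a * x.
  by move=> a0 -> ->; field; rewrite gt_eqF.
pose sqrt_gram (J : 'M[R]_(k, l)) := Num.sqrt (\det (J *m J^T)).
apply: (ratio `|\det A| _ _ _ _ d1).
  exact: etrans (congr1 sqrt_gram E1) (area_density_mul A _).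
exact: etrans (congr1 sqrt_gram E2) (area_density_mul A _).
Qed.

End transport.
End density.

(** * Area measures *)

(** Compactness as an induction principle for passing from charts to a whole closed submanifold: a
    finite subcover is assembled one member at a time. *)
Lemma compact_open_induction (T : ptopologicalType) (K : set T) (P : set T -> Prop) :
  compact K -> P set0 -> (forall U V, open U -> open V -> P U -> P V -> P (U `|` V)) ->
  (forall p, K p -> exists U, [/\ open U, U p & P U]) ->
  exists U, [/\ open U, K `<=` U & P U].
Proof.
rewrite compact_cover => cK P0 PU loc.
have /choice[f fP] p : exists U : set T, K p -> [/\ open U, U p & P U].
  have [Kp|nKp] := pselect (K p); last by exists set0.
  by have [U UP] := loc p Kp; exists U.
have [||s sK Ks] := cK T K f.
- by move=> p /fP[].
- by move=> p Kp; exists p => //; have [] := fP p Kp.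
pose r0 : seq T := finmap.enum_fset s.
have [PB oB] : P (\big[setU/set0]_(p <- r0) f p) /\ open (\big[setU/set0]_(p <- r0) f p).
  have : {subset r0 <= K} by [].
  elim: r0 => [_|p r IH psK]; first by rewrite big_nil; split=> //; exact: open0.
  have Kp : K p by have := psK p (mem_head _ _); rewrite inE.
  have [|Pr oU] := IH; first by move=> q qr; apply: psK; rewrite in_cons qr orbT.
  have [of_ _ Pf] := fP p Kp.
  by rewrite big_cons; split; [exact: PU|exact: openU].
exists (\big[setU/set0]_(p <- r0) f p); split=> // x /Ks[p /= ps fx].
by rewrite -bigcup_seq; exists p.
Qed.

Section area_measure.
Context {R : realType} {k l : nat}.
Implicit Types (S : set 'rV[R]_l) (U : set 'rV[R]_k) (phi : 'rV[R]_k -> 'rV[R]_l).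
Implicit Type mu : {measure set (borel_rV R l) -> \bar R}.

Lemma local_param_measurable S U phi (A : set (borel_rV R l)) :
  local_param S U phi -> measurable A -> measurable (U `&` phi @^-1` A : set (borel_rV R k)).
Proof.
move=> lp; have oU := local_param_open lp.
have : measurable_fun (U : set (borel_rV R k)) (phi : _ -> borel_rV R l).
  apply: measurable_fun_open => V oV; apply: open_borel.
  apply: open_preimage_on => // x Ux.
  exact: local_param_continuous lp Ux.
by apply; exact: open_borel.
Qed.

Lemma area_density_measurable S U phi : local_param S U phi ->
  measurable_fun (U : set (borel_rV R k)) (area_density phi).
Proof.
move=> lp; apply: open_continuous_measurable; first exact: local_param_open lp.
by move=> x Ux; exact: area_density_continuous lp Ux.
Qed.

Section chart_formula.
Context (leb : {sigma_finite_measure set (borel_rV R k) -> \bar R}).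
Hypothesis lebE : forall f : borel_rV R k -> \bar R,
  measurable_fun [set: borel_rV R k] f -> (forall x, 0 <= f x)%E ->
  integral_rV f = (\int[leb]_x f x)%E.

Lemma chart_integral S U phi (A : set (borel_rV R l)) :
  local_param S U phi -> measurable A ->
  integral_rV (fun x => (area_density phi x * \1_(U `&` phi @^-1` A) x)%:E) =
  (\int[leb]_(x in U `&` phi @^-1` A) (area_density phi x)%:E)%E.
Proof.
move=> lp mA; have mUA := local_param_measurable lp mA.
have E x : (area_density phi x * \1_(U `&` phi @^-1` A) x)%:E =
    ((fun x => (area_density phi x)%:E) \_ (U `&` phi @^-1` A)) x.
  by rewrite epatch_indic EFinM.
rewrite lebE.
- by rewrite [RHS]integral_mkcond; apply: eq_integral => x _; rewrite E.
- rewrite (_ : (fun x => _) = ((fun x => (area_density phi x)%:E) \_ (U `&` phi @^-1` A))).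
    apply/(measurable_restrictT _ _).1 => //; apply/measurable_EFinP.
    apply: measurable_funS (area_density_measurable lp); last exact: subIsetl.
    by apply: open_borel; exact: local_param_open lp.
  by apply/funext => x; rewrite E.
- by move=> x; rewrite lee_fin mulr_ge0 ?area_density_ge0.
Qed.

Lemma area_measure_chart S U phi mu (A : set (borel_rV R l)) :
  is_area_measure k S mu -> local_param S U phi -> measurable A -> A `<=` phi @` U ->
  mu A = (\int[leb]_(x in U `&` phi @^-1` A) (area_density phi x)%:E)%E.
Proof. by move=> [_ muE] lp mA AU; rewrite (muE U phi A lp mA AU) (chart_integral lp mA). Qed.

End chart_formula.

Lemma closed_submanifold_closed S : closed_submanifold k S -> closed S.
Proof. by move=> [_ cS]; apply: compact_closed => //; exact: norm_hausdorff. Qed.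

Lemma closed_submanifold_measurable S : closed_submanifold k S ->
  measurable (S : set (borel_rV R l)).
Proof. by move=> /closed_submanifold_closed; exact: closed_borel. Qed.

Lemma local_param_nbhs S U phi u : local_param S U phi -> U u ->
  exists W, [/\ open W, W (phi u) & S `&` W `<=` phi @` U].
Proof.
move=> [_ [W oW [phiU _ _]]] Uu; exists W; split=> //; last by rewrite phiU.
by have [] : (S `&` W) (phi u) by rewrite -phiU; exists u.
Qed.

Local Open Scope ereal_scope.

Lemma area_measure_restrict S mu (A : set (borel_rV R l)) :
  closed_submanifold k S -> is_area_measure k S mu -> measurable A ->
  mu A = mu (A `&` S).
Proof.
move=> cS [mu0 _] mA; have mS := closed_submanifold_measurable cS.
rewrite (measureDI mu mA mS) [X in X + _ = _](_ : _ = 0) ?add0e //.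
apply/eqP; rewrite eq_le measure_ge0 andbT -mu0; apply: le_measure; rewrite ?inE //.
- exact: measurableD.
- exact: measurableC.
Qed.

(** The property P speaks of all measurable parts of [S] inside W, which makes it stable under
    unions: a part of the union of W1 and W2 is split into its trace on W1 and the remainder,
    contained in W2. *)
Lemma area_measure_le S mu (nu : {measure set (borel_rV R l) -> \bar R}) :
  closed_submanifold k S -> is_area_measure k S mu ->
  (forall U phi (A : set (borel_rV R l)), local_param S U phi -> measurable A ->
    A `<=` phi @` U -> mu A <= nu A) ->
  forall A, measurable A -> mu A <= nu A.
Proof.
move=> cS aS chart A mA; have [mS coS] := cS.
have mSb := closed_submanifold_measurable cS.
pose P (W : set 'rV[R]_l) := forall A : set (borel_rV R l), measurable A ->
  A `<=` S `&` W -> mu A <= nu A.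
have [||p Sp|W [oW SW PW]] := @compact_open_induction _ S P coS.
- by move=> B mB B0; rewrite (_ : B = set0) ?measure0 //; apply/seteqP; split=> // x /B0[].
- move=> W1 W2 oW1 oW2 P1 P2 B mB BW.
  have mW1 : measurable (W1 : set (borel_rV R l)) by exact: open_borel.
  rewrite (measureDI mu mB mW1) (measureDI nu mB mW1); apply: leeD.
    apply: P2; first exact: measurableD.
    by move=> x [/BW[Sx [//|W2x]]].
  apply: P1; first exact: measurableI.
  by move=> x [/BW[Sx _] W1x].
- have [U [phi [lp [u Uu up]]]] := mS p Sp.
  have [W [oW Wp SW]] := local_param_nbhs lp Uu.
  exists W; split=> //; first by rewrite -up.
  by move=> B mB BW; apply: (chart U phi) => // x /BW /SW.
rewrite (area_measure_restrict cS aS mA).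
apply: (@le_trans _ _ (nu (A `&` S))).
  apply: PW; first exact: measurableI.
  by move=> x [Ax Sx]; split=> //; exact: SW.
by apply: le_measure; rewrite ?inE //; exact: measurableI.
Qed.

End area_measure.

(** * Gaussian integrands and dominated push-forwards *)

Section gaussian_integrals.
Context {R : realType} {k l : nat}.
Implicit Types (S : set 'rV[R]_l) (U : set 'rV[R]_k) (phi : 'rV[R]_k -> 'rV[R]_l).
Implicit Type mu : {measure set (borel_rV R l) -> \bar R}.

Definition gaussian n (x0 : 'rV[R]_n) (t0 : R) (x : borel_rV R n) : \bar R :=
  (expR (- (enorm ((x : 'rV[R]_n) - x0) ^+ 2) / (4 * t0)))%:E.

Lemma gaussian_ge0 n x0 t0 x : (0 <= @gaussian n x0 t0 x)%E.
Proof. by rewrite lee_fin expR_ge0. Qed.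

Lemma measurable_gaussian n x0 t0 : measurable_fun [set: borel_rV R n] (gaussian x0 t0).
Proof.
have cE : continuous (fun x : 'rV[R]_n => enorm (x - x0)).
  apply: (@lipschitz_continuous _ _ _ _ n%:R) => x y.
  by have := enorm_lipschitz (x - x0) (y - x0); rewrite opprB addrA subrK.
apply/measurable_EFinP; apply: measurableT_comp => //.
apply: measurable_funM => //; apply: measurableT_comp => //; apply: measurable_funX.
exact: continuous_measurable_rV cE.
Qed.

(** The scale enters as distance squared over t, so a dilation of the distance by D is offset by the
    scale [t * D ^+ 2]. *)
Lemma gaussian_le n m (x x0 : 'rV[R]_n) (y y0 : 'rV[R]_m) (t D : R) : 0 < t -> 0 < D ->
  enorm (y - y0) <= D * enorm (x - x0) ->
  (gaussian x0 t x <= gaussian y0 (t * D ^+ 2) y)%E.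
Proof.
move=> t0 D0 yx; rewrite lee_fin ler_expR !mulNr lerN2.
have D2 : 0 < D ^+ 2 by rewrite exprn_gt0.
rewrite ler_pdivrMr ?mulr_gt0 //.
have -> : enorm (x - x0) ^+ 2 / (4 * t) * (4 * (t * D ^+ 2)) = (D * enorm (x - x0)) ^+ 2.
  by field; rewrite gt_eqF.
have D0' := ltW D0.
by rewrite ler_pXn2r ?nnegrE ?mulr_ge0 ?enorm_ge0.
Qed.

End gaussian_integrals.

Section domination.
Local Open Scope ereal_scope.

(** The left side is the integral of f over D against the push-forward by g of mu restricted to E,
    and [dom] says that this push-forward is at most c nu on D. *)
Lemma integral_comp_le d d' (T : measurableType d) (T' : measurableType d') (R : realType)
    (mu : {measure set T -> \bar R}) (nu : {measure set T' -> \bar R})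
    (g : T -> T') (E : set T) (D : set T') (c : R) (f : T' -> \bar R) :
  measurable_fun [set: T] g -> measurable E -> measurable D -> E `<=` g @^-1` D ->
  (0 <= c)%R -> (forall B, measurable B -> B `<=` D -> mu (E `&` g @^-1` B) <= c%:E * nu B) ->
  measurable_fun [set: T'] f -> (forall y, 0 <= f y) ->
  \int[mu]_(x in E) f (g x) <= c%:E * \int[nu]_(y in D) f y.
Proof.
move=> mg mE mD ED c0 dom mf f0.
have mfD : measurable_fun setT (f \_ D).
  by apply/(measurable_restrictT _ _).1 => //; exact: measurable_funTS.
have fD0 y : 0 <= (f \_ D) y by apply: erestrict_ge0.
(* Density 1 on E: [nu0] is mu restricted to E. *)
have [nu0 nu0E] := @exists_density_measure _ _ _ mu E (cst 1%R) mE (measurable_cst _) (fun _ _ => ler01).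
have nu0A A : measurable A -> nu0 A = mu (A `&` E).
  move=> mA; by rewrite nu0E // (integral_cst mu (measurableI _ _ mA mE) 1) mul1e.
have -> : \int[mu]_(x in E) f (g x) = \int[nu0]_(x in E) (f \_ D) (g x).
  rewrite (@integral_density _ _ _ mu nu0 (cst 1%R) E) //.
  - apply: eq_integral => x /[!inE] Ex; rewrite mule1 patchE mem_set //; exact: ED.
  - move=> A mA AE; rewrite nu0E // (setIidl AE) //.
  - by apply: measurable_funTS; exact: measurableT_comp.
have mfg : measurable_fun setT ((f \_ D) \o g) by exact: measurableT_comp.
apply: (@le_trans _ _ (\int[nu0]_x (f \_ D) (g x))).
  by apply: ge0_subset_integral.
have := @ge0_integral_pushforward _ _ _ _ _ _ mg nu0 setT (f \_ D) measurableT mfD (fun y _ => fD0 y).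
rewrite preimage_setT => <-.
have [nu1 nu1E] := exists_pushforward_measure nu0 mg.
rewrite (_ : integral (pushforward nu0 g) _ _ = \int[nu1]_y (f \_ D) y); last first.
  by apply: eq_measure_integral => A mA _; rewrite nu1E.
rewrite [X in _ * X]integral_mkcond -[c]/((NngNum c0)%:num)%R.
rewrite -[leRHS](@ge0_integral_mscale _ _ _ nu _ measurableT) //.
apply: ge0_le_measure_integral => // B mB.
have mgD B' : measurable B' -> measurable (g @^-1` B').
  by move=> mB'; rewrite -[X in measurable X]setTI; exact: mg.
rewrite nu1E nu0A; last exact: mgD.
rewrite (_ : _ `&` E = E `&` g @^-1` (B `&` D)); last first.
  by apply/seteqP; split=> x /= [] => [gB Ex|Ex [gB _]]; split=> //; split=> //; exact: ED.
apply: le_trans (dom _ _ _) _; [exact: measurableI|exact: subIsetr|].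
rewrite /mscale /= lee_wpmul2l ?lee_fin // le_measure ?inE //.
exact: measurableI.
Qed.

End domination.

(** * Comparison of Gaussian integrals under a bi-Lipschitz map *)

Section entropy_comparison.
Context {R : realType} {k l : nat}.
Implicit Types (S : set 'rV[R]_l) (U : set 'rV[R]_k) (phi : 'rV[R]_k -> 'rV[R]_l).
Implicit Type mu : {measure set (borel_rV R l) -> \bar R}.

Lemma bilipschitz_borel C D (Phi Psi : 'rV[R]_l -> 'rV[R]_l) :
  0 < C -> bilipschitz C D Phi Psi ->
  measurable_fun [set: borel_rV R l] (Phi : borel_rV R l -> borel_rV R l).
Proof. by move=> C0 PP; apply: continuous_borel; exact: bilipschitz_continuous (ltW C0) PP. Qed.

Section transport.
Context (S S' : set 'rV[R]_l) (C D : R) (Phi Psi : 'rV[R]_l -> 'rV[R]_l).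
Hypotheses (C0 : 0 < C) (D0 : 0 < D) (PhiPsi : bilipschitz C D Phi Psi).
Hypotheses (dPhi : diffeo S S' Phi) (cS : closed_submanifold k S)
  (cS' : closed_submanifold k S').

Lemma area_measure_transport_le mu mu' (A : set (borel_rV R l)) :
  is_area_measure k S mu -> is_area_measure k S' mu' -> measurable A ->
  (mu' A <= (C ^+ k)%:E * mu (Phi @^-1` A))%E.
Proof.
move=> aS aS'; have [leb lebE] := @exists_lebesgue_rV R k.
have mPhi := bilipschitz_borel C0 PhiPsi.
have [nu nuE] := exists_pushforward_measure mu mPhi.
have Ck : 0 <= C ^+ k by rewrite exprn_ge0 // ltW.
have [PhiK PsiK _ _] := PhiPsi.
move: A; pose nu' : {measure set (borel_rV R l) -> \bar R} := mscale (NngNum Ck) nu.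
have nu'E B : nu' B = ((C ^+ k)%:E * mu (Phi @^-1` B))%E by rewrite -nuE.
suff : forall A, measurable A -> (mu' A <= nu' A)%E.
  by move=> H A /H; rewrite nu'E.
apply: (area_measure_le cS' aS') => U phi' A lp' mA AU.
have lp := local_param_transport D0 PhiPsi.
have PsiPhi := bilipschitz_sym PhiPsi.
have dPsi := diffeo_bilipschitz_inv PhiPsi dPhi.
(* The chart of S' is pulled back to S, so that both measures become integrals over the same subset
   of U and only the densities differ. *)
pose phi := Psi \o phi'.
have {}lp : local_param S U phi by exact: (local_param_transport C0 PsiPhi dPsi lp').
have phi'E : Phi \o phi = phi' by apply/funext => u; rewrite /phi /= PsiK.
have mPA : measurable (Phi @^-1` A : set (borel_rV R l)).
  by rewrite -[X in measurable X]setTI; exact: mPhi.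
have pre : U `&` phi @^-1` (Phi @^-1` A) = U `&` phi' @^-1` A.
  by rewrite -comp_preimage phi'E.
rewrite (area_measure_chart lebE aS' lp' mA AU) nu'E.
rewrite (area_measure_chart lebE aS lp mPA); last first.
  by move=> x /AU[u Uu ux]; exists u => //; rewrite /phi /= ux PhiK.
have mU := local_param_measurable lp' mA.
have mdens phi0 S0 : local_param S0 U phi0 ->
    measurable_fun (U `&` phi' @^-1` A : set (borel_rV R k)) (fun x => (area_density phi0 x)%:E).
  move=> lp0; apply/measurable_EFinP.
  apply: measurable_funS (area_density_measurable lp0); last exact: subIsetl.
  by apply: open_borel; exact: local_param_open lp0.
rewrite pre -ge0_integralZl //.
- apply: ge0_le_integral => //.
  + by move=> x _; rewrite lee_fin area_density_ge0.
  + exact: mdens lp'.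
  + apply: emeasurable_funM; [exact: measurable_cst|exact: mdens lp].
  + move=> x [Ux _]; rewrite -EFinM lee_fin -[in leLHS]phi'E.
    exact: (area_density_transport_le C0 D0 PhiPsi dPhi lp Ux).
- exact: mdens lp.
- by move=> x _; rewrite lee_fin area_density_ge0.
Qed.

Lemma gaussian_transport_le mu mu' (y0 : 'rV[R]_l) (t0 : R) :
  is_area_measure k S mu -> is_area_measure k S' mu' -> 0 < t0 ->
  (\int[mu']_(x in S') gaussian (Phi y0) t0 x <=
   (C ^+ k)%:E * \int[mu]_(x in S) gaussian y0 (t0 * D ^+ 2) x)%E.
Proof.
move=> aS aS' t00.
have [PhiK PsiK _ PsiD] := PhiPsi.
have PsiPhi := bilipschitz_sym PhiPsi.
have mPsi := bilipschitz_borel D0 PsiPhi.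
have mS := closed_submanifold_measurable cS.
have mS' := closed_submanifold_measurable cS'.
apply: (@le_trans _ _ (\int[mu']_(x in S') gaussian y0 (t0 * D ^+ 2) (Psi x))%E).
  apply: ge0_le_integral => //.
  - by move=> x _; exact: gaussian_ge0.
  - by apply: measurable_funTS; exact: measurable_gaussian.
  - apply: measurable_funTS; apply: (measurableT_comp (f := gaussian y0 (t0 * D ^+ 2))) => //.
    exact: measurable_gaussian.
  - move=> x _; apply: gaussian_le => //.
    by rewrite -{1}(PhiK y0); exact: PsiD.
apply: integral_comp_le => //.
- move=> x S'x; rewrite /preimage /=.
  by have := bilipschitz_preimage PhiPsi dPhi => <-; rewrite /preimage /= PsiK.
- by rewrite exprn_ge0 // ltW.
- move=> B mB BS.
  have mB' : measurable (S' `&` Psi @^-1` B : set (borel_rV R l)).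
    by apply: measurableI => //; rewrite -[X in measurable X]setTI; exact: mPsi.
  apply: le_trans (area_measure_transport_le aS aS' mB') _.
  rewrite (_ : Phi @^-1` _ = B) //; apply/seteqP; split=> x /=.
    by move=> [_]; rewrite /preimage /= PhiK.
  move=> Bx; split; last by rewrite /preimage /= PhiK.
  by have := bilipschitz_preimage PhiPsi dPhi => /seteqP[_]; apply; exact: BS.
- exact: measurable_gaussian.
- by move=> y; exact: gaussian_ge0.
Qed.

End transport.
End entropy_comparison.

(** * Finiteness of the entropy *)

Section gaussian_bound.
Context {R : realType} {k l : nat}.
Implicit Types (S : set 'rV[R]_l) (U : set 'rV[R]_k) (phi : 'rV[R]_k -> 'rV[R]_l).
Implicit Type mu : {measure set (borel_rV R l) -> \bar R}.

(** The inverse of the chart is controlled only near [phi u]. Its McShane extension g is Lipschitz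
    on all of R^l, so it can also be applied to the centre of a Gaussian, which may be far from S.
    The bound K is the density at u plus 1, valid nearby by continuity. *)
Lemma local_param_good_nbhs S U phi u : local_param S U phi -> U u ->
  exists (W : set 'rV[R]_l) (g : 'rV[R]_l -> 'rV[R]_k) (D K : R),
    [/\ open W /\ W (phi u), 0 < D /\ 0 < K,
        forall x y, enorm (g x - g y) <= D * enorm (x - y),
        S `&` W `<=` phi @` U &
        forall v, U v -> W (phi v) -> g (phi v) = v /\ area_density phi v <= K].
Proof.
move=> lp Uu; have [V [h [oV Vu Ch hS hK]]] := local_param_inverse lp Uu.
have [r r0 [L L0 hL]] := of_class_lipschitz oV Vu (Ch 1%N).
pose K := area_density phi u + 1.
have K0 : 0 < K by rewrite ltr_wpDl // area_density_ge0.
have near_K : nbhs (phi u) [set x | V x /\ area_density phi (h x) <= K].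
  have hu : h (phi u) = u by exact: hK.
  near=> x; split; first by near: x; exact: (open_nbhs_nbhs (conj oV Vu)).
  apply: ltW; near: x.
  have ch := of_class_continuous (Ch 0%N) Vu.
  have ca : {for h (phi u), continuous (area_density phi)}.
    by rewrite hu; exact: area_density_continuous lp Uu.
  have cah : (area_density phi \o h) x @[x --> phi u] --> area_density phi (h (phi u)).
    exact: continuous_comp ch ca.
  by apply: (cvgr_lt _ cah); rewrite hu /K ltrDl.
have [d /= d0 dV] := (nbhs_ballP _ _).1 near_K.
pose W := ball (phi u) (Num.min r d).
have Wr x : W x -> ball (phi u) r x by apply: le_ball; rewrite ge_min lexx.
have Wd x : W x -> ball (phi u) d x by apply: le_ball; rewrite ge_min lexx orbT.
have hLW x y : W x -> W y -> `|h x - h y| <= L * `|x - y|.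
  by move=> /Wr Wx /Wr Wy; exact: hL.
have [g gh gL] := mcshane_extension_rV (ltW L0) hLW.
exists W, g, (k.+1%:R * L), K; split=> //.
- split; first exact: ball_open.
  by apply: ballxx; rewrite lt_min r0.
- by split=> //; rewrite mulr_gt0.
- move=> x y; apply: le_trans (enorm_le_norm _) _; rewrite -mulrA.
  apply: ler_pM => //; first by rewrite ler_nat.
  by apply: le_trans (gL x y) _; rewrite ler_pM2l // norm_le_enorm.
- move=> x [Sx /Wd/dV[Vx _]]; have [Uhx <-] := hS x Sx Vx.
  by exists (h x).
- move=> v Uv Wv; have [Vv] := dV _ (Wd _ Wv); rewrite (hK v Uv Vv) => aK.
  by rewrite gh // hK.
Unshelve. all: by end_near. Qed.

Local Open Scope ereal_scope.

(** The constant is [M = K * D ^+ k]: K bounds the area density, and [D ^+ k] comes from the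
    Gaussian integral on R^k at the enlarged scale [t0 * D ^+ 2]. *)
Lemma local_gaussian_bound S U phi u mu : closed_submanifold k S ->
  is_area_measure k S mu -> local_param S U phi -> U u ->
  exists W, [/\ open W, W (phi u) & exists2 M : R, (0 <= M)%R &
    forall (x0 : 'rV[R]_l) (t0 : R), (0 < t0)%R ->
      \int[mu]_(x in S `&` W) gaussian x0 t0 x <= (M * Num.sqrt (4 * pi * t0) ^+ k)%:E].
Proof.
move=> cS aS lp Uu.
have [W [g [D [K [[oW Wu] [D0 K0] gD SW gK]]]]] := local_param_good_nbhs lp Uu.
exists W; split=> //; exists (K * D ^+ k)%R => [|x0 t0 t00].
  by rewrite mulr_ge0 ?exprn_ge0 // ltW.
have [leb lebE] := @exists_lebesgue_rV R k.
have mSW : measurable (S `&` W : set (borel_rV R l)).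
  by apply: measurableI; [exact: closed_submanifold_measurable cS|exact: open_borel].
have mg : measurable_fun [set: borel_rV R l] (g : borel_rV R l -> borel_rV R k).
  apply: continuous_borel; apply: (@lipschitz_continuous _ _ _ _ (D * l%:R)) => x y.
  apply: le_trans (norm_le_enorm _) _; apply: le_trans (gD x y) _.
  by rewrite -mulrA ler_pM2l // enorm_le_norm.
apply: (@le_trans _ _ (\int[mu]_(x in S `&` W) gaussian (g x0) (t0 * D ^+ 2) (g x))).
  apply: ge0_le_integral => //.
  - by move=> x _; exact: gaussian_ge0.
  - by apply: measurable_funTS; exact: measurable_gaussian.
  - apply: measurable_funTS; apply: (measurableT_comp (f := gaussian (g x0) (t0 * D ^+ 2))) => //.
    exact: measurable_gaussian.
  - by move=> x _; apply: gaussian_le => //; exact: gD.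
apply: (@le_trans _ _ (K%:E * \int[leb]_y gaussian (g x0) (t0 * D ^+ 2) y)).
  apply: integral_comp_le => //.
  - by rewrite ltW.
  - move=> B mB _.
    have mB' : measurable (S `&` W `&` g @^-1` B : set (borel_rV R l)).
      by apply: measurableI => //; rewrite -[X in measurable X]setTI; exact: mg.
    rewrite (area_measure_chart lebE aS lp mB'); last by move=> x [/SW].
    have mU := local_param_measurable lp mB'.
    apply: (@le_trans _ _ (\int[leb]_(x in U `&` phi @^-1` (S `&` W `&` g @^-1` B)) cst K%:E x)).
      apply: ge0_le_integral => //.
      + by move=> x _; rewrite lee_fin area_density_ge0.
      + apply/measurable_EFinP.
        apply: measurable_funS (area_density_measurable lp); last exact: subIsetl.
        by apply: open_borel; exact: local_param_open lp.
      + by move=> x [Ux [[_ Wx] _]]; rewrite lee_fin; have [] := gK x Ux Wx.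
    rewrite integral_cst // lee_wpmul2l ?lee_fin ?(ltW K0) //.
    apply: le_measure; rewrite ?inE // => x [Ux [[_ Wx] gBx]].
    by have [<- _] := gK x Ux Wx.
  - exact: measurable_gaussian.
  - by move=> y; exact: gaussian_ge0.
rewrite -lebE; last 2 first.
- exact: measurable_gaussian.
- by move=> y; exact: gaussian_ge0.
have tD0 : (0 < t0 * D ^+ 2)%R by rewrite mulr_gt0 // exprn_gt0.
have -> : integral_rV (gaussian (g x0) (t0 * D ^+ 2)) = (Num.sqrt (4 * pi * (t0 * D ^+ 2)) ^+ k)%:E.
  have := integral_rV_gauss (g x0) tD0 ler01; rewrite mul1r => <-.
  by congr integral_rV; apply/funext => y; rewrite /gaussian mul1r.
rewrite -EFinM lee_fin mulrA sqrtrM; last by rewrite !mulr_ge0 ?pi_ge0 // ltW.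
by rewrite sqrtr_sqr ger0_norm ?(ltW D0) // exprMn (mulrC (_ ^+ k)%R (D ^+ k)%R) mulrA.
Qed.

Lemma gaussian_bound S mu : closed_submanifold k S -> is_area_measure k S mu ->
  exists2 M : R, (0 <= M)%R & forall (x0 : 'rV[R]_l) (t0 : R), (0 < t0)%R ->
    \int[mu]_(x in S) gaussian x0 t0 x <= (M * Num.sqrt (4 * pi * t0) ^+ k)%:E.
Proof.
move=> cS aS; have [mS coS] := cS.
have mSb := closed_submanifold_measurable cS.
pose P (W : set 'rV[R]_l) := exists2 M : R, (0 <= M)%R &
  forall (x0 : 'rV[R]_l) (t0 : R), (0 < t0)%R ->
    \int[mu]_(x in S `&` W) gaussian x0 t0 x <= (M * Num.sqrt (4 * pi * t0) ^+ k)%:E.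
have mgS x0 t0 (A : set (borel_rV R l)) : measurable_fun A (gaussian x0 t0).
  by apply: measurable_funTS; exact: measurable_gaussian.
have [||p Sp|W [oW SW [M M0 MP]]] := @compact_open_induction _ S P coS.
- by exists 0%R => // x0 t0 t00; rewrite setI0 integral_set0 mul0r.
- move=> W1 W2 oW1 oW2 [M1 M10 P1] [M2 M20 P2]; exists (M1 + M2)%R; first exact: addr_ge0.
  move=> x0 t0 t00.
  have m1 : measurable (S `&` W1 : set (borel_rV R l)).
    by apply: measurableI => //; exact: open_borel.
  have m2 : measurable (S `&` W2 : set (borel_rV R l)).
    by apply: measurableI => //; exact: open_borel.
  have mD : measurable ((S `&` W2) `\` (S `&` W1) : set (borel_rV R l)).
    exact: measurableD.
  rewrite (_ : S `&` (W1 `|` W2) = S `&` W1 `|` (S `&` W2) `\` (S `&` W1)); last first.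
    apply/seteqP; split=> [x [Sx [W1x|W2x]]|x [[Sx W1x]|[[Sx W2x] _]]].
    - by left.
    - by have [W1x|nW1x] := pselect (W1 x); [left|right; split=> // -[]].
    - by split=> //; left.
    - by split=> //; right.
  rewrite ge0_integral_setU //.
  - rewrite mulrDl EFinD; apply: leeD; first exact: P1.
    apply: le_trans (P2 x0 t0 t00); apply: ge0_subset_integral => //.
    + by move=> x _; exact: gaussian_ge0.
  - by move=> x _; exact: gaussian_ge0.
  - by rewrite disj_set2E setDIK.
- have [U [phi [lp [u Uu up]]]] := mS p Sp.
  have [W [oW Wp [M M0 MP]]] := local_gaussian_bound cS aS lp Uu.
  by exists W; split; [by []|by rewrite -up|by exists M].
- by exists M => // x0 t0 t00; rewrite -{1}(setIidl SW); exact: MP.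
Qed.

End gaussian_bound.

(** * Transport of area measures *)

Section area_measure_transport.
Context {R : realType} {k l : nat}.
Implicit Types (S : set 'rV[R]_l) (U : set 'rV[R]_k) (phi : 'rV[R]_k -> 'rV[R]_l).

Lemma within_continuous_measurable n (S : set 'rV[R]_n) (f : 'rV[R]_n -> R) :
  measurable (S : set (borel_rV R n)) -> {within S, continuous f} ->
  measurable_fun (S : set (borel_rV R n)) f.
Proof.
move=> mS /continuousP cf.
apply: (measurability _ (measurable_realfun.RGenOpens.measurableE R)).
move=> _ [_ [a [b ->] <-]].
have oI : open `]a, b[%classic by exact: interval_open.
have /open_subspaceP[V oV VS] := cf _ oI.
rewrite setIC -VS; apply: measurableI => //; exact: open_borel.
Qed.

Context (S S' : set 'rV[R]_l) (C D : R) (Phi Psi : 'rV[R]_l -> 'rV[R]_l).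
Hypotheses (C0 : 0 < C) (D0 : 0 < D) (PhiPsi : bilipschitz C D Phi Psi).
Hypotheses (dPhi : diffeo S S' Phi) (cS : closed_submanifold k S).

(** J is chosen point by point. In a chart it is the quotient of two continuous positive densities
    composed with the inverse chart, so it is continuous on S and therefore Borel. *)
Lemma exists_measurable_area_jacobian : exists2 J : 'rV[R]_l -> R,
  measurable_fun (S : set (borel_rV R l)) J &
  forall p, S p -> 0 <= J p /\ forall U phi u, local_param S U phi -> U u ->
    phi u = p -> area_density (Phi \o phi) u = J p * area_density phi u.
Proof.
have [mS _] := cS; have mSb := closed_submanifold_measurable cS.
have /choice[J JP] p : exists j : R, S p -> 0 <= j /\
    forall U phi u, local_param S U phi -> U u ->
    phi u = p -> area_density (Phi \o phi) u = j * area_density phi u.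
  have [Sp|nSp] := pselect (S p); last by exists 0.
  by have [j j0 jP] := exists_area_jacobian D0 PhiPsi dPhi mS Sp; exists j.
exists J => //; apply: within_continuous_measurable => //.
apply/subspace_continuousP => p Sp.
have [U [phi [lp [u Uu up]]]] := mS p Sp.
have lp' := local_param_transport D0 PhiPsi dPhi lp.
have [V [h [oV Vu Ch hS hK]]] := local_param_inverse lp Uu.
have hu : h (phi u) = u by exact: hK.
pose ratio v := area_density (Phi \o phi) v / area_density phi v.
have Jratio x : S x -> V x -> J x = ratio (h x).
  move=> Sx Vx; have [Uhx phx] := hS x Sx Vx; have [_ Jx] := JP x Sx.
  by rewrite /ratio (Jx _ _ _ lp Uhx phx) mulfK // gt_eqF //; exact: area_density_gt0 lp Uhx.
have cratio : {for h (phi u), continuous ratio}.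
  rewrite hu; apply: continuousM.
    exact: area_density_continuous lp' Uu.
  apply: continuousV; last exact: area_density_continuous lp Uu.
  by rewrite gt_eqF //; exact: area_density_gt0 lp Uu.
have crh : (ratio \o h) x @[x --> p] --> ratio (h (phi u)).
  rewrite -[in X in nbhs X]up; apply: (continuous_comp _ cratio).
  exact: of_class_continuous (Ch 0%N) Vu.
have -> : from_subspace S J p = ratio (h (phi u)).
  by rewrite up; apply: Jratio => //; rewrite -up.
apply: cvg_trans (cvg_within_filter _ crh).
apply: near_eq_cvg; rewrite near_withinE; near=> x => Sx; apply/esym/Jratio => //.
by near: x; apply: open_nbhs_nbhs; split=> //; rewrite -up.
Unshelve. all: by end_near. Qed.

Lemma exists_area_measure_transport :
  (exists mu, is_area_measure k S mu) -> exists mu, is_area_measure k S' mu.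
Proof.
move=> [mu aS]; have mS := closed_submanifold_measurable cS.
have [PhiK PsiK _ _] := PhiPsi.
have mPhi : measurable_fun [set: borel_rV R l] (Phi : borel_rV R l -> borel_rV R l).
  by apply: continuous_borel; exact: bilipschitz_continuous (ltW C0) PhiPsi.
have [leb lebE] := @exists_lebesgue_rV R k.
have [J mJ JP] := exists_measurable_area_jacobian.
have J0 x : S x -> 0 <= J x by move=> Sx; have [] := JP x Sx.
have [nu nuE] := exists_density_measure mu mS mJ J0.
have [mu' mu'E] := exists_pushforward_measure nu mPhi.
have mpre (A : set (borel_rV R l)) : measurable A -> measurable (Phi @^-1` A : set (borel_rV R l)).
  by move=> mA; rewrite -[X in measurable X]setTI; exact: mPhi.
have preS := bilipschitz_preimage PhiPsi dPhi.
exists mu'; split=> [|U phi' A lp' mA AU].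
  have mC : measurable (~` S : set (borel_rV R l)) by exact: measurableC.
  have E : Phi @^-1` (~` S') = ~` S by rewrite -preS.
  by rewrite mu'E E nuE // setICl integral_set0.
rewrite mu'E nuE; last exact: mpre.
have PsiPhi := bilipschitz_sym PhiPsi.
have dPsi := diffeo_bilipschitz_inv PhiPsi dPhi.
have lp : local_param S U (Psi \o phi') by exact: (local_param_transport C0 PsiPhi dPsi lp').
set phi := Psi \o phi' in lp.
have phi'E : Phi \o phi = phi' by apply/funext => u; rewrite /phi /= PsiK.
have AS : Phi @^-1` A `<=` S.
  by rewrite -preS => x /AU[u Uu ux]; rewrite /preimage /= -ux; exact: local_param_S lp' Uu.
rewrite (setIidl AS).
set E : set (borel_rV R l) := Phi @^-1` A.
have mE : measurable E by exact: mpre.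
have EU : E `<=` phi @` U.
  by move=> x /AU[u Uu ux]; exists u => //; rewrite /phi /= ux PhiK.
have oU := local_param_open lp; have mU : measurable (U : set (borel_rV R k)) by exact: open_borel.
have mdens := area_density_measurable lp.
have [nu1 nu1E] := exists_density_measure leb mU mdens (fun x _ => area_density_ge0 phi x).
(* Extending phi by 0 off U gives a Borel map on all of R^k; [nu1] has no mass off U, so the value
   there does not affect the push-forward. *)
pose phi0 : borel_rV R k -> borel_rV R l := patch (cst 0) U phi.
have phi0U x : U x -> phi0 x = phi x by move=> Ux; rewrite /phi0 /patch mem_set.
have pre0 (A0 : set (borel_rV R l)) : phi0 @^-1` A0 `&` U = U `&` phi @^-1` A0.
  by apply/seteqP; split=> x; [case=> + Ux|case=> Ux]; rewrite /preimage /= phi0U.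
have mphi0 : measurable_fun [set: borel_rV R k] phi0.
  apply: measurable_fun_open => V oV; rewrite setTI.
  rewrite -(setUIDK (phi0 @^-1` V) U) pre0; apply: measurableU.
    by apply: local_param_measurable lp _; exact: open_borel.
  have [V0|nV0] := pselect (V 0).
    rewrite (_ : _ `\` _ = ~` U); first exact: measurableC.
    apply/seteqP; split=> [x []//|x nUx]; split=> //.
    by rewrite /preimage /= /phi0 /patch memNset.
  rewrite (_ : _ `\` _ = set0) //; apply/seteqP; split=> // x [].
  by rewrite /preimage /= /phi0 /patch => + nUx; rewrite memNset.
have m0E : measurable (phi0 @^-1` E) by rewrite -[X in measurable X]setTI; exact: mphi0.
have mJE : measurable_fun E (fun x => (J x)%:E).
  by apply/measurable_EFinP; exact: measurable_funS mJ.
(* Inside the chart, mu is the push-forward of the area density; the integral of J becomes one over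
   U, where J times the density of phi is the density of phi'. *)
rewrite (@eq_measure_integral _ _ _ E (pushforward nu1 phi0)); last first.
  move=> A0 mA0 A0E; have A0U := subset_trans A0E EU.
  have mp0 : measurable (phi0 @^-1` A0).
    by rewrite -[X in measurable X]setTI; exact: mphi0.
  apply: (etrans (area_measure_chart lebE aS lp mA0 A0U)).
  by apply: esym; apply: (etrans (nu1E _ mp0)); rewrite pre0.
rewrite ge0_integral_pushforward //; last first.
  by move=> x /[!inE] /AS Sx; rewrite lee_fin J0.
pose h x := area_density phi x * \1_U x.
have hE x : (h x)%:E = ((fun y => (area_density phi y)%:E) \_ U) x.
  by rewrite epatch_indic EFinM.
have mh (B : set (borel_rV R k)) : measurable_fun B h.
  apply: measurable_funTS; apply/measurable_EFinP.
  rewrite (_ : _ \o _ = (fun y => (area_density phi y)%:E) \_ U).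
    by apply/(measurable_restrictT _ _).1 => //; exact/measurable_EFinP.
  by apply/funext => x; rewrite -hE.
rewrite (@integral_density _ _ _ leb nu1 h) //; last 4 first.
- by move=> x _; rewrite mulr_ge0 // area_density_ge0.
- move=> A0 mA0 _; rewrite nu1E // integral_mkcondr.
  by apply: eq_integral => x _; rewrite hE.
- apply: (@measurable_comp _ _ _ _ _ _ E) => //; last exact: measurable_funTS.
  by move=> _ [x + <-].
- by move=> x /AS Sx; rewrite lee_fin J0.
rewrite (chart_integral lebE lp' mA) -phi'E.
rewrite [RHS](_ : _ = \int[leb]_(x in phi0 @^-1` E `&` U) (area_density phi' x)%:E)%E; last first.
  by rewrite pre0 /E -comp_preimage phi'E.
rewrite integral_mkcondr; apply: eq_integral => x _ /=.
rewrite patchE; case: ifPn => [/set_mem Ux|]; last first.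
  by rewrite notin_setE => nUx; rewrite /h indicE memNset // mulr0 mule0.
rewrite /h indicE mem_set // mulr1 phi0U // -EFinM; congr EFin.
rewrite -phi'E; have [_ Jx] := JP (phi x) (local_param_S lp Ux).
exact/esym/(Jx _ _ _ lp Ux).
Qed.

End area_measure_transport.

(** * Smooth families *)

Section family.
Context {R : realType} {N : nat}.

Definition slice (x : 'rV[R]_N) (s : R) : 'rV[R]_(N + 1) := row_mx x (s%:M : 'rV[R]_1).

Lemma slice_ball (x x' : 'rV[R]_N) (s s' d : R) :
  ball x d x' -> `|s - s'| < d -> ball (slice x s) d (slice x' s').
Proof.
move=> xx' ss'; have d0 : 0 < d by case: xx'.
apply/(ball_rV _ _ d0) => j; rewrite !mxE.
case: splitP => i _; first by move/(ball_rV _ _ d0): xx'; exact.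
by rewrite !mxE ord1 eqxx !mulr1n.
Qed.

Lemma is_derive_slice (f : 'rV[R]_(N + 1) -> R) x s i :
  derivable f (slice x s) (e_ (lshift 1 i)) ->
  is_derive x (e_ i) (fun y => f (slice y s)) ('D_(e_ (lshift 1 i)) f (slice x s)).
Proof.
have E : (fun h : R => h^-1 *: (((fun y => f (slice y s)) \o shift x) (h *: e_ i) -
     f (slice x s))) = (fun h => h^-1 *: ((f \o shift (slice x s)) (h *: e_ (lshift 1 i)) -
     f (slice x s))).
  apply/funext => h /=; congr (_ *: (f _ - _)).
  apply/rowP => j; rewrite /slice !mxE; case: splitP => m jm; rewrite !mxE -!val_eqE /= jm //.
  have -> : (N + m == i)%N = false by rewrite gtn_eqF // ltn_addr.
  by rewrite ?andbF mulr0 add0r.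
by move=> df; apply: DeriveDef; rewrite /derivable /derive E.
Qed.

(** The space partials of g at times s and s' both lie close to those at the point (x, s), so their
    difference is small on a whole ball around x. *)
Lemma slice_difference_lipschitz m (U : set 'rV[R]_(N + 1))
    (g : 'rV[R]_(N + 1) -> 'rV[R]_m) x s (e : R) :
  open U -> U (slice x s) -> of_class 1 U g -> 0 < e ->
  exists2 d : R, 0 < d & (forall x' s', ball x d x' -> `|s - s'| < d -> U (slice x' s')) /\
    forall x' y' s', ball x d x' -> ball x d y' -> `|s - s'| < d ->
    `|(g (slice x' s') - g (slice y' s')) - (g (slice x' s) - g (slice y' s))| <= e * `|x' - y'|.
Proof.
move=> oU Ux Cg e0.
have Cgj := (of_classP 1 g oU).1 Cg.
(* The 2 accounts for comparing both times with (x, s), the other factor for the dimension in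
   [lipschitz_partials]. *)
pose e1 := e / (N.+1%:R * 2).
have e10 : 0 < e1 by rewrite divr_gt0 // mulr_gt0.
have : nbhs (slice x s) [set z | U z /\ forall ij : 'I_(N + 1) * 'I_m,
    `|'D_(e_ ij.1) (fun y => g y 0 ij.2) z - 'D_(e_ ij.1) (fun y => g y 0 ij.2) (slice x s)| <= e1].
  near=> z; split; first by near: z; exact: (open_nbhs_nbhs (conj oU Ux)).
  move=> ij; move: ij; near: z; apply: filter_forall => -[i j] /=.
  have [_ /(_ i)[_ [cD _]]] := Cgj j.
  have /cvgrPdist_le/(_ _ e10) := cD _ Ux; apply: filterS => z.
  by rewrite distrC.
move=> /nbhs_ballP[d /= d0 dU].
exists d => //; split.
  by move=> x' s' xx' ss'; have [] := dU _ (slice_ball xx' ss').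
move=> x' y' s' x'B y'B s'B.
apply: rV_norm_le => [|j]; first by rewrite mulr_ge0 // ltW.
pose h w := g (slice w s') 0 j - g (slice w s) 0 j.
have ss0 : `|s - s| < d by rewrite subrr normr0.
have Dh w i : ball x d w -> is_derive w (e_ i) h
    ('D_(e_ (lshift 1 i)) (fun y => g y 0 j) (slice w s') -
     'D_(e_ (lshift 1 i)) (fun y => g y 0 j) (slice w s)).
  move=> wB; have [_ /(_ (lshift 1 i))[dg _]] := Cgj j.
  have [U1 _] := dU _ (slice_ball wB s'B); have [U2 _] := dU _ (slice_ball wB ss0).
  by apply: is_deriveB; apply: is_derive_slice; apply: dg.
have -> : ((g (slice x' s') - g (slice y' s')) - (g (slice x' s) - g (slice y' s))) 0 j = h x' - h y'.
  by rewrite !mxE /h; ring.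
apply: le_trans (@lipschitz_partials R N h x d (e1 *+ 2) _ _ x' y' x'B y'B) _.
- by move=> i w wB; have [] := Dh w i wB.
- move=> i w wB; have [_ ->] := Dh w i wB.
  have [_ /(_ (lshift 1 i, j)) b1] := dU _ (slice_ball wB s'B).
  have [_ /(_ (lshift 1 i, j)) b2] := dU _ (slice_ball wB ss0).
  rewrite mulr2n; apply: le_trans (lerD b1 b2) => /=.
  by rewrite [X in _ <= _ + X]distrC; exact: ler_distD.
- apply: ler_wpM2r => //.
  have -> : e1 *+ 2 = e / N.+1%:R.
    by rewrite /e1 invfM mulrA -mulrnAr -[2^-1 *+ 2]mulr_natr mulVf ?mulr1.
  by rewrite mulrCA ler_piMr ?(ltW e0) // ler_pdivrMr // mul1r ler_nat.
Unshelve. all: by end_near. Qed.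

(** The condition on e reads [4 * e = L * (|a - b| - 2 * e)]: four errors accumulate on the left,
    and [|a1 - b1|] falls short of [|a - b|] by at most two. *)
Lemma perturbed_difference (V : normedModType R) (a b a1 a2 b1 b2 : V) (e L : R) :
  0 < L -> e * (4 + 2 * L) = L * `|a - b| ->
  `|a - a1| <= e -> `|a - a2| <= e -> `|b - b1| <= e -> `|b - b2| <= e ->
  `|(a2 - b2) - (a1 - b1)| <= L * `|a1 - b1|.
Proof.
move=> L0 eE h1 h2 h3 h4.
have lower : `|a - b| - 2 * e <= `|a1 - b1|.
  by have := ler_distD a1 a b; have := ler_distD b1 a1 b; rewrite (distrC b1 b); lra.
have upper : `|(a2 - b2) - (a1 - b1)| <= 4 * e.
  have -> : (a2 - b2) - (a1 - b1) = ((a - a1) - (a - a2)) + ((b - b2) - (b - b1)).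
    rewrite !opprB [a - a1 + _]addrC [b - b2 + _]addrC !subrKA.
    by rewrite addrACA [RHS]addrACA [- b2 - a1]addrC.
  have := ler_normD ((a - a1) - (a - a2)) ((b - b2) - (b - b1)).
  by have := ler_normB (a - a1) (a - a2); have := ler_normB (b - b2) (b - b1); lra.
apply: le_trans upper _; apply: (@le_trans _ _ (L * (`|a - b| - 2 * e))).
  by rewrite mulrBr -eE; nra.
by rewrite ler_pM2l.
Qed.

(* Off the diagonal the estimate is continuity, near the diagonal it is the mean
   value inequality for [g (., s') - g (., s)]. *)
Lemma family_lipschitz_close l (M : set 'rV[R]_N) (S : set 'rV[R]_l)
    (F : 'rV[R]_(N + 1) -> 'rV[R]_l) (G : 'rV[R]_l -> 'rV[R]_N) (s L : R) :
  compact M ->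
  smooth_on [set z | exists (x : 'rV[R]_N) (s : R), [/\ M x, 0 <= s <= 1 &
                                z = row_mx x (s%:M : 'rV[R]_1)]] F ->
  0 <= s <= 1 -> (forall x, M x -> S (F (slice x s))) ->
  smooth_on S G -> (forall x, M x -> G (F (slice x s)) = x) -> 0 < L ->
  \forall s' \near within `[0, 1] (nbhs s), forall x y, M x -> M y ->
    `|(F (slice x s') - F (slice y s')) - (F (slice x s) - F (slice y s))| <=
    L * `|F (slice x s) - F (slice y s)|.
Proof.
move=> cM; set A := (X in smooth_on X F) => sF s01 MS sG GK L0.
have inA x s' : M x -> 0 <= s' <= 1 -> A (slice x s') by move=> Mx s'01; exists x, s'.
have cF x (e : R) : M x -> 0 < e -> exists2 d : R, 0 < d &
    forall x' s', M x' -> 0 <= s' <= 1 -> ball x d x' -> `|s - s'| < d ->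
      `|F (slice x s) - F (slice x' s')| <= e.
  move=> Mx e0; have [U [g [oU Ux Cg Fg]]] := sF _ (inA x s Mx s01).
  have /cvgrPdist_le/(_ e e0) : g z @[z --> slice x s] --> g (slice x s).
    exact: of_class_continuous (Cg 0%N) Ux.
  move=> ge.
  have : nbhs (slice x s) (U `&` [set z | `|g (slice x s) - g z| <= e]).
    by apply: filterI => //; exact: (open_nbhs_nbhs (conj oU Ux)).
  move=> /nbhs_ballP[d /= d0 dU]; exists d => // x' s' Mx' s'01 xx' ss'.
  have [Ux' gx'] := dU _ (slice_ball xx' ss').
  by rewrite !Fg //; exact: inA.
pose P (s' : R) (xy : 'rV[R]_N * 'rV[R]_N) := M xy.1 -> M xy.2 ->
    `|(F (slice xy.1 s') - F (slice xy.2 s')) - (F (slice xy.1 s) - F (slice xy.2 s))| <=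
    L * `|F (slice xy.1 s) - F (slice xy.2 s)|.
suff : \forall s' \near within `[0, 1] (nbhs s), M `*` M `<=` P s'.
  by apply: filterS => s' H x y Mx My; apply: (H (x, y)).
(* Compactness of M x M turns radii depending on the pair (x, y) into a single neighbourhood of
   s. *)
have /compact_near_coveringP := compact_setX cM cM; apply => -[x y] [/= Mx My].
suff [d d0 dP] : exists2 d : R, 0 < d & forall x' y' s', M x' -> M y' -> 0 <= s' <= 1 ->
    ball x d x' -> ball y d y' -> `|s - s'| < d ->
    `|(F (slice x' s') - F (slice y' s')) - (F (slice x' s) - F (slice y' s))| <=
    L * `|F (slice x' s) - F (slice y' s)|.
  exists (ball (x, y) d, [set s' | 0 <= s' <= 1 /\ `|s - s'| < d]) => /=.
    split; first exact: nbhsx_ballx.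
    have in01 : within `[0, 1] (nbhs s) `[0, 1]%classic by exact: withinT.
    have near_s : within `[0, 1] (nbhs s) (ball s d).
      by apply: filterS (nbhsx_ballx s d d0) => s' ? _.
    apply: filterS (filterI in01 near_s) => s' [] /=; rewrite in_itv /= => s'01.
    by rewrite -ball_normE.
  move=> [[x' y'] s'] /= [[/= xx' yy'] [s'01 ss']] /= Mx' My'.
  exact: dP.
have [xy|xy] := eqVneq x y.
  move: My; rewrite -xy => _.
  have [r1 r10 [L1 L10 GL]] := smooth_on_lipschitz sG (MS x Mx).
  have [U [g [oU Ux Cg Fg]]] := sF _ (inA x s Mx s01).
  (* Since [L1] is a local Lipschitz constant of the inverse [G], distances in M are at most [L1]
     times those in S, and a tolerance [L / L1] on M becomes L on S. *)
  have e0 : 0 < L / L1 by rewrite divr_gt0.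
  have [d1 d10 [dU dg]] := slice_difference_lipschitz oU Ux (Cg 1%N) e0.
  have [d2 d20 dF] := cF x (r1 / 2) Mx (divr_gt0 r10 (ltr0n R 2)).
  exists (Num.min d1 d2); first by rewrite lt_min d10.
  have le1 : Num.min d1 d2 <= d1 by rewrite ge_min lexx.
  have le2 : Num.min d1 d2 <= d2 by rewrite ge_min lexx orbT.
  move=> x' y' s' Mx' My' s'01 /[dup] /(le_ball le1) x1 /(le_ball le2) x2
    /[dup] /(le_ball le1) y1 /(le_ball le2) y2 ss'.
  have ss1 := lt_le_trans ss' le1; have ss2 := lt_le_trans ss' le2.
  have s1 : `|s - s| < d1 by rewrite subrr normr0.
  have s2 : `|s - s| < d2 by rewrite subrr normr0.
  have FB z : M z -> ball x d2 z -> ball (F (slice x s)) r1 (F (slice z s)).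
    move=> Mz xz; rewrite -ball_normE /=; apply: le_lt_trans (dF z s Mz s01 xz s2) _.
    by rewrite ltr_pdivrMr // ltr_pMr // ltr1n.
  have := GL _ _ (MS _ Mx') (MS _ My') (FB _ Mx' x2) (FB _ My' y2).
  rewrite !GK // => xyL.
  have := dg x' y' s' x1 y1 ss1.
  rewrite -(Fg _ (inA _ _ Mx' s'01) (dU _ _ x1 ss1)) -(Fg _ (inA _ _ My' s'01) (dU _ _ y1 ss1)).
  rewrite -(Fg _ (inA _ _ Mx' s01) (dU _ _ x1 s1)) -(Fg _ (inA _ _ My' s01) (dU _ _ y1 s1)).
  move=> H; apply: le_trans H _.
  rewrite -mulrA ler_pM2l // ler_pdivrMl //.
have Fxy : 0 < `|F (slice x s) - F (slice y s)|.
  rewrite normr_gt0 subr_eq0; apply: contra_neq xy => Fxy.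
  by rewrite -(GK x Mx) -(GK y My) Fxy.
set del := `|F (slice x s) - F (slice y s)| in Fxy.
pose e := L * del / (4 + 2 * L).
have L42 : 0 < 4 + 2 * L by rewrite addr_gt0 // mulr_gt0.
have e0 : 0 < e by rewrite divr_gt0 // mulr_gt0.
have [d1 d10 dF1] := cF x e Mx e0.
have [d2 d20 dF2] := cF y e My e0.
exists (Num.min d1 d2); first by rewrite lt_min d10.
have le1 : Num.min d1 d2 <= d1 by rewrite ge_min lexx.
have le2 : Num.min d1 d2 <= d2 by rewrite ge_min lexx orbT.
move=> x' y' s' Mx' My' s'01 /(le_ball le1) x1 /(le_ball le2) y2 ss'.
have ss1 := lt_le_trans ss' le1; have ss2 := lt_le_trans ss' le2.
have s1 : `|s - s| < d1 by rewrite subrr normr0.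
have s2 : `|s - s| < d2 by rewrite subrr normr0.
have eE : e * (4 + 2 * L) = L * del by rewrite /e divfK // gt_eqF.
exact: (perturbed_difference L0 eE (dF1 _ _ Mx' s01 x1 s1) (dF1 _ _ Mx' s'01 x1 ss1)
  (dF2 _ _ My' s01 y2 s2) (dF2 _ _ My' s'01 y2 ss2)).
Unshelve. all: by end_near. Qed.

End family.

(** * Entropy *)

Section entropy.
Context {R : realType} {k l : nat}.
Implicit Types (S : set 'rV[R]_l).

Lemma area_measureP S : (exists mu, is_area_measure k S mu) ->
  is_area_measure k S (area_measure k S).
Proof. by move=> ex; rewrite /area_measure; case: pselect => // ex'; exact: svalP (cid ex'). Qed.

Lemma gauss_constant (t : R) : 0 < t ->
  (4 * pi * t) `^ (k%:R / 2) = Num.sqrt (4 * pi * t) ^+ k.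
Proof.
move=> t0; have c0 : 0 <= 4 * pi * t by rewrite !mulr_ge0 ?pi_ge0 // ltW.
by rewrite (mulrC k%:R) powRrM powR12_sqrt // powR_mulrn // sqrtr_ge0.
Qed.

Lemma gauss_constant_gt0 (t : R) : 0 < t -> 0 < Num.sqrt (4 * pi * t) ^+ k.
Proof. by move=> t0; rewrite exprn_gt0 // sqrtr_gt0 !mulr_gt0 // pi_gt0. Qed.

Lemma gauss_FE x0 (t0 : R) S : 0 < t0 -> gauss_F k x0 t0 S =
  ((Num.sqrt (4 * pi * t0) ^+ k)^-1%:E *
   \int[area_measure k S]_(x in S) gaussian x0 t0 x)%E.
Proof. by move=> t00; rewrite /gauss_F gauss_constant. Qed.

Lemma gauss_F_ge0 x0 (t0 : R) S : 0 < t0 -> (0 <= gauss_F k x0 t0 S)%E.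
Proof.
move=> t00; rewrite gauss_FE // mule_ge0 ?lee_fin ?invr_ge0 ?(ltW (gauss_constant_gt0 t00)) //.
by apply: integral_ge0 => x _; exact: gaussian_ge0.
Qed.

Lemma entropy_ge0 S : (0 <= entropy k S)%E.
Proof.
apply: le_trans (gauss_F_ge0 0 S ltr01) _.
by apply: ereal_sup_ubound; exists 0, 1.
Qed.

Lemma gauss_F_le_entropy x0 (t0 : R) S : 0 < t0 -> (gauss_F k x0 t0 S <= entropy k S)%E.
Proof. by move=> t00; apply: ereal_sup_ubound; exists x0, t0. Qed.

(** Here [area_measure] takes its default value, the zero measure. *)
Lemma entropy_no_area_measure S : ~ (exists mu, is_area_measure k S mu) ->
  entropy k S = 0%E.
Proof.
move=> nex; apply/eqP; rewrite eq_le entropy_ge0 andbT.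
apply: ge_ereal_sup => _ [x0 [t0 [t00 ->]]].
rewrite gauss_FE // /area_measure; case: pselect => // _.
by rewrite integral_measure_zero mule0.
Qed.

(** The bound of [gaussian_bound] grows with the scale exactly like the normalising factor, so its
    constant M bounds every [gauss_F]. *)
Lemma entropy_fin_num S : closed_submanifold k S -> entropy k S \is a fin_num.
Proof.
move=> cS; rewrite fin_real // (lt_le_trans _ (entropy_ge0 S)) ?ltNy0 //=.
have [ex|nex] := pselect (exists mu, is_area_measure k S mu); last first.
  by rewrite entropy_no_area_measure // ltry.
have [M M0 MP] := gaussian_bound cS (area_measureP ex).
apply: (@le_lt_trans _ _ M%:E); last exact: ltry.
apply: ge_ereal_sup => _ [x0 [t0 [t00 ->]]].
rewrite gauss_FE // muleC lee_pdivrMr ?gauss_constant_gt0 //.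
by rewrite -EFinM; exact: MP.
Qed.

Lemma entropy_transport_le S S' C D (Phi Psi : 'rV[R]_l -> 'rV[R]_l) :
  0 < C -> 0 < D -> bilipschitz C D Phi Psi -> diffeo S S' Phi ->
  closed_submanifold k S -> closed_submanifold k S' ->
  (entropy k S' <= ((C * D) ^+ k)%:E * entropy k S)%E.
Proof.
move=> C0 D0 PP dPhi cS cS'.
have CDk : 0 <= (C * D) ^+ k by rewrite exprn_ge0 // mulr_ge0 // ltW.
have PP' := bilipschitz_sym PP; have dPsi := diffeo_bilipschitz_inv PP dPhi.
have [ex'|nex'] := pselect (exists mu, is_area_measure k S' mu); last first.
  by rewrite entropy_no_area_measure // mule_ge0 // ?lee_fin // entropy_ge0.
(* Transport backwards by [Psi]: the chosen measures of S and S' are then both genuine area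
   measures. *)
have ex := exists_area_measure_transport D0 C0 PP' dPsi cS' ex'.
have [PhiK PsiK _ _] := PP.
apply: ge_ereal_sup => _ [x0 [t0 [t00 ->]]].
rewrite -(PsiK x0); set y0 := Psi x0.
have tD : 0 < t0 * D ^+ 2 by rewrite mulr_gt0 // exprn_gt0.
have c0 := gauss_constant_gt0 t00.
apply: (@le_trans _ _ (((C * D) ^+ k)%:E * gauss_F k y0 (t0 * D ^+ 2) S)%E); last first.
  by rewrite lee_wpmul2l ?lee_fin //; exact: gauss_F_le_entropy.
rewrite !gauss_FE //.
apply: (@le_trans _ _ ((Num.sqrt (4 * pi * t0) ^+ k)^-1%:E *
   ((C ^+ k)%:E * \int[area_measure k S]_(x in S) gaussian y0 (t0 * D ^+ 2) x))%E).
  rewrite lee_wpmul2l ?lee_fin ?invr_ge0 ?(ltW c0) //.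
  exact: (gaussian_transport_le C0 D0 PP dPhi cS cS' y0 (area_measureP ex) (area_measureP ex')).
rewrite !muleA -!EFinM lee_wpmul2r //.
  by apply: integral_ge0 => x _; exact: gaussian_ge0.
rewrite lee_fin le_eqVlt; apply/orP; left; apply/eqP.
(* The change of scale in the normalisation supplies the factor [D ^+ k]. *)
have -> : Num.sqrt (4 * pi * (t0 * D ^+ 2)) = Num.sqrt (4 * pi * t0) * D.
  rewrite mulrA sqrtrM ?sqrtr_sqr ?(ger0_norm (ltW D0)) //.
  by rewrite !mulr_ge0 ?pi_ge0 // ltW.
rewrite !exprMn; set c := Num.sqrt _ ^+ k in c0 *.
have Dk : 0 < D ^+ k by rewrite exprn_gt0.
by field; rewrite !gt_eqF.
Qed.

End entropy.

Unset Implicit Arguments.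

Theorem proposition5p5 (R : realType) (k l : nat) (alpha : R)
  (Sigma : R -> set 'rV[R]_l)
  (halpha : 0 < alpha < 1)
  (hfamily : smooth_family k Sigma)
  (hgraph : locally_graphically_bounded k alpha Sigma) :
  (forall s : R, 0 <= s <= 1 -> entropy k (Sigma s) \is a fin_num) /\
  {within `[0, 1], continuous (fun s : R => fine (entropy k (Sigma s)))}.
Proof.
have [cSigma [N [M [F [[_ cM] sF slices]]]]] := hfamily.
have fin s : 0 <= s <= 1 -> entropy k (Sigma s) \is a fin_num.
  by move=> /cSigma; exact: entropy_fin_num.
split=> //; apply/subspace_continuousP => s; rewrite /= in_itv /= => s01.
set a := fine (entropy k (Sigma s)).
have a0 : 0 <= a by apply: fine_ge0; exact: entropy_ge0.
(* The loss factor [(C * D) ^+ k] for the constants of [perturbation_bilipschitz]. *)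
pose K (q : R) := ((1 + q) * (1 - q)^-1) ^+ k.
have cK : {for 0, continuous K}.
  apply: (@continuous_comp _ _ _ (fun q : R => (1 + q) * (1 - q)^-1) (fun r => r ^+ k)).
    apply: continuousM; first by apply: continuousD; [exact: cst_continuous|exact: cvg_id].
    apply: continuousV; first by rewrite subr0 oner_eq0.
    by apply: continuousB; [exact: cst_continuous|exact: cvg_id].
  exact: exprn_continuous.
have K0 : K 0 = 1 by rewrite /K subr0 addr0 invr1 mulr1 expr1n.
apply/cvgrPdist_le => e e0.
have [q [q0 q1 Kq]] : exists q, [/\ 0 < q, q < 1 & (K q - 1) * a <= e].
  (* Dividing by [a + 1] rather than a covers the case a = 0. *)
  have e1 : 0 < e / (a + 1) by rewrite divr_gt0 // ltr_wpDl.
  have /cvgrPdist_le/(_ _ e1)/nbhs_ballP[d /= d0 dK] := cK.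
  have d2 : 0 < d / 2 by rewrite divr_gt0.
  exists (Num.min (d / 2) 2^-1); set q := Num.min _ _.
  have q0 : 0 < q by rewrite lt_min d2 invr_gt0 ltr0n.
  have qd : q <= d / 2 by rewrite ge_min lexx.
  split=> //; first by rewrite gt_min invf_lt1 // ltr1n orbT.
  have : ball 0 d q by rewrite -ball_normE /= sub0r normrN gtr0_norm //; lra.
  move=> /dK /=; rewrite K0 distrC => /(le_trans (ler_norm _)) Kq.
  apply: le_trans (ler_wpM2r a0 Kq) _.
  by rewrite mulrAC ler_pdivrMr ?ltr_wpDl // ler_pM2l // lerDl.
pose L := q / l.+1%:R.
have L0 : 0 < L by rewrite divr_gt0.
have qE : l.+1%:R * L = q by rewrite /L mulrC divfK.
have [Fs sFs [G sG GK]] := slices s s01.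
have MS x : M x -> Sigma s (F (slice x s)) by move=> Mx; rewrite -Fs; exists x.
have close := family_lipschitz_close cM sF s01 MS sG GK L0.
have in01 : within `[0, 1] (nbhs s) `[0, 1]%classic by exact: withinT.
apply: filterS (filterI in01 close) => s' []; rewrite /= in_itv /= => s'01 lip.
have dG : diffeo (Sigma s) M G by exact: diffeo_inv (slices s s01) GK.
have MG p : Sigma s p -> M (G p) /\ F (slice (G p) s) = p.
  by rewrite -Fs => -[x Mx <-]; rewrite GK.
(* The map being extended follows the family: it sends the point of parameter x at time s to the
   point of the same parameter at time s'. *)
have [||x y Sx Sy|Phi [Psi [PhiE PP]]] := @perturbation_bilipschitz R l (Sigma s)
    (fun p => F (slice (G p) s')) L.
- exact: ltW.
- by rewrite qE.
- have [Mx xE] := MG x Sx; have [My yE] := MG y Sy.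
  by have := lip _ _ Mx My; rewrite xE yE.
rewrite qE in PP.
have dPhi : diffeo (Sigma s) (Sigma s') Phi.
  apply: diffeo_eq (diffeo_comp dG (slices s' s'01)) => x Sx.
  by rewrite PhiE.
have C0 : 0 < 1 + q by rewrite addr_gt0.
have D0 : 0 < (1 - q)^-1 by rewrite invr_gt0 subr_gt0.
have le1 := entropy_transport_le C0 D0 PP dPhi (cSigma s s01) (cSigma s' s'01).
have le2 := entropy_transport_le D0 C0 (bilipschitz_sym PP)
  (diffeo_bilipschitz_inv PP dPhi) (cSigma s' s'01) (cSigma s s01).
rewrite mulrC -/(K q) in le2.
set b := fine (entropy k (Sigma s')).
have aE : entropy k (Sigma s) = a%:E by rewrite fineK // fin.
have bE : entropy k (Sigma s') = b%:E by rewrite fineK // fin.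
rewrite aE bE -EFinM lee_fin in le1; rewrite aE bE -EFinM lee_fin in le2.
have b0 : 0 <= b by apply: fine_ge0; exact: entropy_ge0.
have K1 : 1 <= K q.
  by rewrite exprn_ege1 // ler_pdivlMr ?subr_gt0 // mul1r; lra.
rewrite mulrBl mul1r in Kq.
rewrite ler_norml; apply/andP; split.
  by rewrite lerNl opprB (le_trans _ Kq) // lerD2r; exact: le1.
(* When b <= a, [a - b] is at most [(K q - 1) * b], hence at most [(K q - 1) * a]: the choice of q,
   made for a alone, suffices in both directions. *)
have [ab|/ltW ba] := leP a b.
  by apply: (le_trans _ (ltW e0)); rewrite subr_le0.
rewrite (le_trans _ Kq) //; apply: (@le_trans _ _ (K q * b - b)).
  by rewrite lerD2r; exact: le2.
rewrite -[X in _ - X <= _]mul1r -[X in _ <= _ - X]mul1r -!mulrBl.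
by rewrite ler_wpM2l // subr_ge0.
Qed.
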